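(* Let $p\in[1,\infty)$ and let $\nu$ be a Borel measure on $\mathbb{R}^d$ with $\int_{\mathbb{R}^d}(1\wedge|x|^p)\,\nu(\mathrm{d}x)<\infty$. Assume that $\nu$ is absolutely continuous with a radially symmetric density whose radial profile has lower Matuszewska index at zero strictly bigger than $-d-1$. Then there are constants $c_1,c_2>0$, independent of $r$ and $x$, such that for all $r>0$ and $x\in\mathbb{R}^d$, $$c_1\, r^d\left(1+h_p(r)\right)\le \mathrm{Cap}_{\nu,p}(B(x,r))\le c_2\, r^d\left(1+h_p(r)\right).$$
   Context: $B(x,r)$ is the ball in $\mathbb{R}^d$ with center $x$ and radius $r$. For $r>0$, $$h_p(r)=\int_{\mathbb{R}^d}\left(1\wedge\frac{|x|^p}{r^p}\right)\nu(\mathrm{d}x).$$ The nonlocal Sobolev space is $W_p^{\nu}=\{f:\ \|f\|_{W_p^{\nu}}:=\|f\|_p+[f]_{W_p^{\nu}}<\infty\}$, where $\|f\|_p$ is the $L^p(\mathbb{R}^d)$ norm and $$[f]_{W_p^{\nu}}=\left(\int_{\mathbb{R}^d}\int_{\mathbb{R}^d}|f(x+h)-f(x)|^p\,\mathrm{d}x\,\nu(\mathrm{d}h)\right)^{1/p}.$$ The $W_p^\nu$-capacity of a set $E\subset\mathbb{R}^d$ is $$\mathrm{Cap}_{\nu,p}(E)=\inf\{\|f\|_{W_p^{\nu}}^p:\ f\in W_p^{\nu}\text{ and }E\subset\operatorname{int}(\{f\ge1\})\}.$$ The lower Matuszewska index at zero of a function $\varphi:(0,\infty)\to(0,\infty)$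 is the supremum of those $a\in\mathbb{R}$ for which there exist $A,R_0>0$ such that $\varphi(r_2)/\varphi(r_1)\ge A\,(r_2/r_1)^{a}$ whenever $0<r_1<r_2<R_0$. *)

(* Defs.v *)
From HB Require Import structures.
From mathcomp Require Import all_boot all_order all_algebra.
From mathcomp Require Import all_classical all_reals all_analysis.
From mathcomp Require Import measurable_realfun.

Set Implicit Arguments.
Unset Strict Implicit.
Unset Printing Implicit Defensive.

Import Order.TTheory GRing.Theory Num.Theory.
Import numFieldNormedType.Exports.

Local Open Scope classical_set_scope.
Local Open Scope ring_scope.

(* R^d is 'rV[R]_d with its library topology and module structure. The library
   puts no measurable structure on row vectors: equip them with the Borel
   sigma-algebra. *)
Section borel_rV.
Context {R : realType} {n : nat}.

Definition borel_rV_display : measure_display.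
Proof. exact: default_measure_display. Qed.

Definition borel_rV : set_system 'rV[R]_n := <<s [set U | open U] >>.

Let borel_rV0 : borel_rV set0.
Proof. exact: sigma_algebra0. Qed.

Let borel_rVC A : borel_rV A -> borel_rV (~` A).
Proof. exact: sigma_algebraC. Qed.

Let borel_rV_bigcup (F : (set 'rV[R]_n)^nat) :
  (forall i, borel_rV (F i)) -> borel_rV (\bigcup_i F i).
Proof. exact: sigma_algebra_bigcup. Qed.

HB.instance Definition _ := @isMeasurable.Build borel_rV_display
  'rV[R]_n borel_rV borel_rV0 borel_rVC borel_rV_bigcup.

End borel_rV.

Lemma open_measurable_rV (R : realType) n (U : set 'rV[R]_n) :
  open U -> measurable U.
Proof. by move=> oU; apply: sub_sigma_algebra. Qed.

Lemma measurable_coord_rV (R : realType) n (i : 'I_n) :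
  measurable_fun [set: 'rV[R]_n] (fun v : 'rV[R]_n => v ord0 i).
Proof.
apply: (measurability _ (RGenOpens.measurableE R)).
move=> _ [_ [a [b ->] <-]]; rewrite setTI; apply: open_measurable_rV.
have /continuousP := @coord_continuous R 1 n ord0 i.
apply; exact: interval_open.
Qed.

Lemma open_rV_bigcup_box (R : realType) n (U : set 'rV[R]_n) : open U ->
  U = \bigcup_(ab in [set ab : 'rV[rat]_n * 'rV[rat]_n |
        [set v : 'rV[R]_n | forall i,
          ratr (ab.1 ord0 i) < v ord0 i < ratr (ab.2 ord0 i)] `<=` U])
      [set v : 'rV[R]_n | forall i,
          ratr (ab.1 ord0 i) < v ord0 i < ratr (ab.2 ord0 i)].
Proof.
move=> oU; apply/seteqP; split => [x Ux|x [ab abU xab]]; last exact: abU.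
have /nbhs_ballP[e /= e0 xeU] := open_nbhs_nbhs (conj oU Ux).
have lo i : exists q : rat, x ord0 i - e < ratr q < x ord0 i.
  have /rat_in_itvoo[q] : x ord0 i - e < x ord0 i by rewrite gtrBl.
  by rewrite in_itv /= => ?; exists q.
have hi i : exists q : rat, x ord0 i < ratr q < x ord0 i + e.
  have /rat_in_itvoo[q] : x ord0 i < x ord0 i + e by rewrite ltrDl.
  by rewrite in_itv /= => ?; exists q.
have [a aP] := choice lo; have [b bP] := choice hi.
exists (\row_i a i, \row_i b i) => /=; last first.
  move=> i; rewrite !mxE.
  by have /andP[_ ->] := aP i; have /andP[-> _] := bP i.
move=> v vab; apply: xeU; split=> // k j; rewrite (ord1 k).
have := vab j; rewrite !mxE => /andP[av vb].
have /andP[ea _] := aP j; have /andP[_ be] := bP j.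
rewrite /ball /= ltr_distlC; apply/andP; split.
  exact: lt_trans av.
exact: lt_trans be.
Qed.

Lemma measurable_fun_rVP d (T : measurableType d) (R : realType) n
    (f : T -> 'rV[R]_n) :
  measurable_fun setT f <->
  (forall i, measurable_fun setT (fun x => f x ord0 i)).
Proof.
split=> [mf i|mf].
  exact: (measurableT_comp (@measurable_coord_rV R n i) mf).
apply: (measurability [set U : set 'rV[R]_n | open U]) => //.
move=> _ [U /= oU <-]; rewrite setTI (open_rV_bigcup_box oU).
rewrite preimage_bigcup bigcup_mkcond.
apply: countable_bigcupT_measurable; first exact: countableP.
move=> [a b]; case: ifPn => //= _.
rewrite [X in measurable X](_ : _ = \bigcap_(i in [set: 'I_n])
    ((fun x => f x ord0 i) @^-1` `]ratr (a ord0 i), ratr (b ord0 i)[%classic)).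
  apply: fin_bigcap_measurable => // i _.
  by rewrite -[X in measurable X]setTI; apply: mf.
apply/seteqP; split=> [x /= xab i _|x xab i] /=.
  by rewrite in_itv; exact: xab.
by have := xab i Logic.I; rewrite /= in_itv.
Qed.

Section lebesgue_rV.
Context {R : realType}.
Local Open Scope ereal_scope.

Section cons.
Context {n : nat}.

Definition cons_rV (xy : measurableTypeR R * 'rV[R]_n) : 'rV[R]_n.+1 :=
  row_mx (const_mx xy.1 : 'rV_1) xy.2.

Definition uncons_rV (v : 'rV[R]_n.+1) : measurableTypeR R * 'rV[R]_n :=
  (v ord0 ord0, \row_i v ord0 (lift ord0 i)).

Lemma cons_rV0 xy : cons_rV xy ord0 ord0 = xy.1.
Proof.
rewrite /cons_rV (_ : ord0 = lshift n (ord0 : 'I_1)); last exact: val_inj.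
by rewrite (row_mxEl (const_mx xy.1 : 'rV_1)) mxE.
Qed.

Lemma cons_rV_lift xy i : cons_rV xy ord0 (lift ord0 i) = xy.2 ord0 i.
Proof.
rewrite /cons_rV (_ : lift ord0 i = rshift 1 i); last exact: val_inj.
by rewrite (row_mxEr (const_mx xy.1 : 'rV_1)).
Qed.

Lemma cons_rVK : cancel cons_rV uncons_rV.
Proof.
move=> [x y]; rewrite /uncons_rV cons_rV0; congr pair.
by apply/rowP => i; rewrite mxE cons_rV_lift.
Qed.

Lemma measurable_cons_rV : measurable_fun setT cons_rV.
Proof.
apply/measurable_fun_rVP => i.
case: (unliftP ord0 i) => [j ->|->].
  under eq_fun do rewrite cons_rV_lift.
  exact: (measurableT_comp (@measurable_coord_rV R n j) measurable_snd).
under eq_fun do rewrite cons_rV0.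
exact: measurable_fst.
Qed.

Lemma measurable_uncons_rV : measurable_fun setT uncons_rV.
Proof.
apply/measurable_fun_pairP; split; first exact: measurable_coord_rV.
apply/measurable_fun_rVP => i; rewrite /comp /=.
under eq_fun do rewrite mxE.
exact: measurable_coord_rV.
Qed.

HB.instance Definition _ := isMeasurableFun.Build _ _ _ _
  cons_rV measurable_cons_rV.

End cons.

Section step.
Context {n : nat}.
Variable mu : {sigma_finite_measure set 'rV[R]_n -> \bar R}.

Definition lebesgue_rV_step : set 'rV[R]_n.+1 -> \bar R :=
  pushforward (lebesgue_measure \x mu) cons_rV.

Let lebesgue_rV_step0 : lebesgue_rV_step set0 = 0.
Proof. exact: measure0. Qed.

Let lebesgue_rV_step_ge0 A : 0 <= lebesgue_rV_step A.
Proof. exact: measure_ge0. Qed.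

Let lebesgue_rV_step_sigma_additive : semi_sigma_additive lebesgue_rV_step.
Proof. exact: measure_semi_sigma_additive. Qed.

HB.instance Definition _ := isMeasure.Build _ _ _ lebesgue_rV_step
  lebesgue_rV_step0 lebesgue_rV_step_ge0 lebesgue_rV_step_sigma_additive.

Lemma lebesgue_rV_step_sigma_finite : sigma_finite setT lebesgue_rV_step.
Proof.
have /sigma_finiteP[F [TF ndF Foo]] := sigma_finiteT (@lebesgue_measure R).
have /sigma_finiteP[G [TG ndG Goo]] := sigma_finiteT mu.
exists (fun k => uncons_rV @^-1` (F k `*` G k)).
  rewrite -preimage_bigcup (_ : \bigcup_k _ = setT) ?preimage_setT//.
  apply/seteqP; split=> // -[x y] _.
  have [a _ Fax] : (\bigcup_k F k) x by rewrite -TF.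
  have [b _ Gby] : (\bigcup_k G k) y by rewrite -TG.
  exists (maxn a b) => //; split=> /=.
  - by move: x Fax; exact/subsetPset/ndF/leq_maxl.
  - by move: y Gby; exact/subsetPset/ndG/leq_maxr.
move=> k; have [mF Fk] := Foo k; have [mG Gk] := Goo k.
have mFG : measurable (F k `*` G k) by exact: measurableX.
split; first by rewrite -[X in measurable X]setTI; exact: measurable_uncons_rV.
rewrite /lebesgue_rV_step /pushforward -comp_preimage.
rewrite (_ : _ \o _ = id); last by apply/funext => xy; exact: cons_rVK.
rewrite preimage_id product_measure1E//.
by rewrite lte_mul_pinfty// ge0_fin_numE.
Qed.

HB.instance Definition _ := Measure_isSigmaFinite.Build _ _ _
  lebesgue_rV_step lebesgue_rV_step_sigma_finite.

End step.

(* Lebesgue measure on R^n, as an iterated product; it is characterized by its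
   values on boxes, see lebesgue_rV_box below. *)
Fixpoint lebesgue_rV (n : nat) :
    {sigma_finite_measure set 'rV[R]_n -> \bar R} :=
  if n is m.+1 then lebesgue_rV_step (lebesgue_rV m)
  else \d_(0%R : 'rV[R]_0).

Lemma lebesgue_rV_box n (A : 'I_n -> set (measurableTypeR R)) :
  (forall i, measurable (A i)) ->
  lebesgue_rV n [set v | forall i, A i (v ord0 i)] =
  \prod_(i < n) lebesgue_measure (A i).
Proof.
elim: n A => [|n IH] A mA.
  rewrite big_ord0 /= diracE mem_set // => -[]//.
rewrite big_ord_recl -IH //= -product_measure1E //.
- rewrite /lebesgue_rV_step /pushforward; congr (product_measure1 _ _ _).
  apply/seteqP; split => [[x y]|[x y]] /=.
    move=> h; split; first by have := h ord0; rewrite cons_rV0.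
    by move=> i; have := h (lift ord0 i); rewrite cons_rV_lift.
  move=> [hx hy] i; case: (unliftP ord0 i) => [j ->|->].
    by rewrite cons_rV_lift; exact: hy.
  by rewrite cons_rV0.
- rewrite (_ : (fun _ => _) = \bigcap_(i in [set: 'I_n])
    ((fun v : 'rV[R]_n => v ord0 i) @^-1` A (lift ord0 i))).
    apply: fin_bigcap_measurable => // i _.
    rewrite -[X in measurable X]setTI.
    by apply: measurable_coord_rV => //; exact: mA.
  by apply/seteqP; split=> [x /= xab i _|x xab i] //=; exact: xab.
Qed.

End lebesgue_rV.

(* The library norm on 'rV[R]_d is the sup norm, hence explicit Euclidean norm
   and balls; the topology is the same. *)
Definition enorm {R : realType} {d} (x : 'rV[R]_d) : R :=
  Num.sqrt (\sum_(i < d) x ord0 i ^+ 2).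

Definition eball {R : realType} {d} (x : 'rV[R]_d) (r : R) : set 'rV[R]_d :=
  [set y | enorm (y - x) < r].

(* Only the values of phi on (0, +oo) matter. The index may be +oo (or -oo),
   hence the supremum is taken in \bar R. *)
Definition lower_matuszewska0 {R : realType} (phi : R -> R) : \bar R :=
  ereal_sup [set a%:E | a in [set a : R | exists A R0 : R,
    [/\ 0 < A, 0 < R0 & forall r1 r2 : R, 0 < r1 -> r1 < r2 -> r2 < R0 ->
      A * (r2 / r1) `^ a <= phi r2 / phi r1]]].

Section capacity.
Context {R : realType} {d : nat}.
Implicit Types (p r : R) (f k : 'rV[R]_d -> R) (E : set 'rV[R]_d).

Definition has_density (nu : {measure set 'rV[R]_d -> \bar R}) k : Prop :=
  [/\ measurable_fun setT k, forall x, 0 <= k x &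
   forall A, measurable A ->
     nu A = (\int[lebesgue_rV d]_(x in A) (k x)%:E)%E].

(* The origin is exempted: a radial profile is only defined on (0, +oo). *)
Definition has_radial_profile k (phi : R -> R) : Prop :=
  forall x, x != 0 -> k x = phi (enorm x).

Variable nu : {measure set 'rV[R]_d -> \bar R}.
Local Open Scope ereal_scope.

Definition hfun p r : \bar R :=
  \int[nu]_x (Order.min 1 (enorm x `^ p / r `^ p))%R%:E.

Definition sobolev_seminorm p f : \bar R :=
  (\int[nu]_h \int[lebesgue_rV d]_x (`|f (x + h) - f x| `^ p)%R%:E) `^ p^-1.

Definition sobolev_norm p f : \bar R :=
  'N[lebesgue_rV d]_p%:E[EFin \o f] + sobolev_seminorm p f.

Definition sobolev_space p : set ('rV[R]_d -> R) :=
  [set f | measurable_fun setT f /\ sobolev_norm p f < +oo].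

Definition capacity p E : \bar R :=
  ereal_inf [set sobolev_norm p f `^ p | f in
    [set f | sobolev_space p f /\ E `<=` interior [set x | (1 <= f x)%R]]].

End capacity.

(* Main.v *)
(** Upper bound: test with the cutoff [max 0 (min 1 (2 - |y - x| / r))]; its
    increment by [h] is at most [min 1 (|h| / r)] and lives on two cubes of side
    [4 r], so its Gagliardo energy is at most a constant times [r^d h_p(r)].

    Lower bound: the index condition gives [1 < q < 2] with
    [phi s <= K (2^d q)^m phi (2^m s)] at small scales.  Summing over dyadic
    shells, [h_p(r)] is then bounded by a constant plus a multiple of
    [sum_(i <= N) s_i^d phi(2 s_i)], where [s_i = 2^i r] and [s_N] is of order 1.
    Let [f >= 1] on the ball, and let [Q_i] be a cube of side of order [s_i] at
    distance of order [s_i] from [x].  Put [u = q / 2^d < 1] and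
    [t_i = u^(i/p) / 2], and let [J] be the last scale at which [f >= t_J] on at
    least half of [Q_J].  For [i > J], [f <= 1/2] on half of [Q_i], so the pairs
    (ball, Q_i) contribute [r^d s_i^d phi(2 s_i)] to the energy.  The scales
    [i <= J] sum up geometrically to at most a multiple of
    [u^J s_J^(2d) phi(2 s_J)], which is paid for by the drop of [f] from [t_J]
    on half of [Q_J] to below [t_(J+1)] on half of [Q_(J+1)], or, if [J = N],
    by the [L^p] norm of [f] on [Q_N].  That [q < 2 <= 2^d] (subcriticality) is
    where the threshold [-d-1] enters. *)

From HB Require Import structures.
Require Import Defs.
From mathcomp Require Import all_boot all_order all_algebra.
From mathcomp Require Import all_classical all_reals all_analysis.
From mathcomp Require Import measurable_realfun ring lra.

Set Implicit Arguments.
Unset Strict Implicit.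
Unset Printing Implicit Defensive.

Import Order.TTheory GRing.Theory Num.Theory.
Import numFieldNormedType.Exports.

Local Open Scope classical_set_scope.
Local Open Scope ring_scope.

(** * Lebesgue measure on row vectors and densities *)

Section euclidean_measure.
Context {R : realType} {d : nat}.
Implicit Types x h c : 'rV[R]_d.

Lemma measurable_add_rV :
  measurable_fun setT (fun hx : 'rV[R]_d * 'rV[R]_d => hx.2 + hx.1).
Proof.
apply/measurable_fun_rVP => i; under eq_fun do rewrite mxE.
apply: measurable_funD.
  exact: (measurableT_comp (@measurable_coord_rV R d i) measurable_snd).
exact: (measurableT_comp (@measurable_coord_rV R d i) measurable_fst).
Qed.

Lemma measurable_translate_rV c : measurable_fun setT (fun v : 'rV[R]_d => v + c).
Proof.
apply/measurable_fun_rVP => i; under eq_fun do rewrite mxE.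
by apply: measurable_funD => //; exact: measurable_coord_rV.
Qed.

Lemma measurable_enorm : measurable_fun setT (@enorm R d).
Proof.
rewrite /enorm; apply: (measurableT_comp (continuous_measurable_fun (@sqrt_continuous R))).
apply: measurable_sum => i; apply: measurable_funX.
exact: measurable_coord_rV.
Qed.

Definition rbox (a b : 'rV[R]_d) : set 'rV[R]_d :=
  [set v | forall i, a ord0 i < v ord0 i < b ord0 i].

Lemma rboxE a b : rbox a b =
  [set v | forall i, `]a ord0 i, b ord0 i[%classic (v ord0 i)].
Proof. by apply/seteqP; split=> v /= + i => /(_ i); rewrite in_itv. Qed.

Lemma rbox_itvs (A : 'I_d -> set (measurableTypeR R)) : (forall i, measurable (A i)) ->
  measurable [set v : 'rV[R]_d | forall i, A i (v ord0 i)].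
Proof.
move=> mA; rewrite (_ : mkset _ = \bigcap_(i in [set: 'I_d])
    ((fun v : 'rV[R]_d => v ord0 i) @^-1` A i)).
  apply: fin_bigcap_measurable => // i _.
  rewrite -[X in measurable X]setTI.
  by apply: measurable_coord_rV => //; exact: mA.
by apply/seteqP; split=> [v Av i _|v Av i] //=; exact: Av.
Qed.

Lemma measurable_rbox a b : measurable (rbox a b).
Proof.
rewrite rboxE.
apply: (rbox_itvs (A := fun i => `]a ord0 i, b ord0 i[%classic)) => i.
exact: measurable_itv.
Qed.

Lemma lebesgue_rbox (a b : 'rV[R]_d) : (forall i, a ord0 i <= b ord0 i) ->
  lebesgue_rV d (rbox a b) = (\prod_(i < d) (b ord0 i - a ord0 i))%:E.
Proof.
move=> ab; rewrite rboxE.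
rewrite (lebesgue_rV_box (A := fun i => `]a ord0 i, b ord0 i[%classic));
  last first.
  by move=> i; exact: measurable_itv.
rewrite -prodEFin; apply: eq_bigr => i _.
rewrite lebesgue_measure_itv /= lte_fin; have := ab i.
by rewrite le_eqVlt => /predU1P[->|->//]; rewrite ltxx subrr.
Qed.

Lemma rbox_setI_closed : setI_closed [set A | exists a b, A = rbox a b].
Proof.
move=> _ _ [a [b ->]] [a' [b' ->]].
exists (\row_i Num.max (a ord0 i) (a' ord0 i)).
exists (\row_i Num.min (b ord0 i) (b' ord0 i)).
apply/seteqP; split=> [v [/= va va'] i|v /= va].
  by rewrite !mxE gt_max lt_min; move: (va i) (va' i) => /andP[-> ->] /andP[-> ->].
split=> i /=; move: (va i); rewrite !mxE gt_max lt_min.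
  by move=> /andP[/andP[-> _] /andP[-> _]].
by move=> /andP[/andP[_ ->] /andP[_ ->]].
Qed.

(** Every open set is a countable union of open boxes with rational corners. With [rbox_setI_closed]
    this makes the boxes a generating pi-system, on which measures can be compared. *)
Lemma measurable_rV_generated :
  measurable = <<s [set A : set 'rV[R]_d | exists a b, A = rbox a b] >>.
Proof.
apply/seteqP; split; last first.
  apply: smallest_sub; first exact: sigma_algebra_measurable.
  by move=> _ [a [b ->]]; exact: measurable_rbox.
apply: smallest_sub; first exact: smallest_sigma_algebra.
move=> U oU; rewrite (open_rV_bigcup_box oU) bigcup_mkcond.
set G := (X in <<s X >>).
apply: (@countable_bigcupT_measurable _ (g_sigma_algebraType G)).
  exact: countableP.
move=> [a b]; case: ifPn => //= _; apply: sub_sigma_algebra.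
exists (\row_i ratr (a ord0 i)), (\row_i ratr (b ord0 i)).
by apply/seteqP; split=> v /= + i => /(_ i); rewrite !mxE.
Qed.

(** Uniqueness of measures: the Lebesgue measure and its push-forward under the translation agree on
    boxes, and the cubes [g n] of finite volume exhaust the space. *)
Lemma lebesgue_rV_translate c (A : set 'rV[R]_d) : measurable A ->
  lebesgue_rV d ((fun v => v + c) @^-1` A) = lebesgue_rV d A.
Proof.
move=> mA; pose f := fun v : 'rV[R]_d => v + c.
have mf : measurable_fun setT f := measurable_translate_rV c.
pose f_mf := isMeasurableFun.Build _ _ _ _ f mf.
pose F : {mfun 'rV[R]_d >-> 'rV[R]_d} := HB.pack f f_mf.
apply/esym; pose g n : set 'rV[R]_d := rbox (const_mx (- n%:R)) (const_mx n%:R).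
apply: (measure_unique [set A | exists a b, A = rbox a b] g
  measurable_rV_generated rbox_setI_closed _ _ (lebesgue_rV d)
  (pushforward (lebesgue_rV d) F)) => //.
- by move=> n; exists (const_mx (- n%:R)), (const_mx n%:R).
- apply/seteqP; split=> // v _.
  pose s := \sum_(i < d) `|v ord0 i|.
  exists (Num.truncn s).+1 => // i; rewrite !mxE -ltr_norml.
  have: s < (Num.truncn s).+1%:R by exact: truncnS_gt.
  by apply: le_lt_trans; rewrite /s (bigD1 i) //= lerDl sumr_ge0.
- move=> _ [a [b ->]].
  have pre : F @^-1` rbox a b = rbox (a - c) (b - c).
    apply/seteqP; split=> v /= + i => /(_ i); rewrite !mxE.
      by rewrite ltrBlDr ltrBrDr.
    by rewrite ltrBlDr ltrBrDr.
  rewrite [RHS](_ : _ = lebesgue_rV d (rbox (a - c) (b - c))); last first.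
    by rewrite -pre.
  (* [lebesgue_rbox] asks for ordered corners. If they are reversed in some coordinate, both boxes
     are empty. *)
  have [ab|/existsNP[i /negP]] := pselect (forall i, a ord0 i <= b ord0 i).
    rewrite [LHS](lebesgue_rbox ab) [RHS]lebesgue_rbox; last first.
      by move=> i; rewrite !mxE lerD2r.
    by congr (_%:E); apply: eq_bigr => i _; rewrite !mxE; ring.
  rewrite -ltNge => ba.
  have e (a' b' : 'rV[R]_d) : b' ord0 i < a' ord0 i -> rbox a' b' = set0.
    move=> ba'; apply/seteqP; split=> // v /(_ i) /andP[av vb].
    by have := lt_trans ba' (lt_trans av vb); rewrite ltxx.
  by rewrite !e ?measure0 // !mxE ltrD2r.
- move=> k; rewrite [X in (X < _)%E]lebesgue_rbox ?ltry // => i; rewrite !mxE.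
  by rewrite lerNl (le_trans _ (ler0n _ _)) // oppr_le0.
Qed.

Definition cube c (r : R) : set 'rV[R]_d := [set v | forall i, `|v ord0 i - c ord0 i| < r].

Lemma cubeE c r : cube c r = rbox (c - const_mx r) (c + const_mx r).
Proof.
by apply/seteqP; split=> v /= + i => /(_ i); rewrite !mxE ltr_distl.
Qed.

Lemma measurable_cube c r : measurable (cube c r).
Proof. by rewrite cubeE; exact: measurable_rbox. Qed.

Lemma lebesgue_cube c r : 0 <= r ->
  lebesgue_rV d (cube c r) = ((2 * r) ^+ d)%:E.
Proof.
move=> r0; rewrite cubeE lebesgue_rbox; last first.
  by move=> i; rewrite !mxE lerD2l; lra.
congr EFin; rewrite (eq_bigr (fun=> 2 * r)).
  by rewrite prodr_const card_ord.
by move=> i _; rewrite !mxE; ring.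
Qed.

Lemma ler_coord_enorm x i : `|x ord0 i| <= enorm x.
Proof.
rewrite -sqrtr_sqr; apply: ler_wsqrtr; rewrite (bigD1 i) //= lerDl sumr_ge0 // => j _.
exact: sqr_ge0.
Qed.

Lemma enorm_ge0 x : 0 <= enorm x.
Proof. exact: sqrtr_ge0. Qed.

Lemma enorm_le_sum x : enorm x <= \sum_(i < d) `|x ord0 i|.
Proof.
rewrite -(@ler_pXn2r _ 2) // ?nnegrE ?enorm_ge0 ?sumr_ge0 //.
rewrite sqr_sqrtr; last by apply: sumr_ge0 => i _; exact: sqr_ge0.
rewrite expr2 mulr_suml; apply: ler_sum => i _.
rewrite -real_normK ?num_real // expr2.
apply: ler_wpM2l => //; rewrite (bigD1 i) //= lerDl sumr_ge0 //.
Qed.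

Lemma enorm_neq0 x : 0 < enorm x -> x != 0.
Proof.
apply: contraTneq => ->; rewrite -leNgt (le_trans (enorm_le_sum 0)) //.
by rewrite big1 // => i _; rewrite mxE normr0.
Qed.

End euclidean_measure.

(** * Integration against a measure with a density *)

Section density.
Context {R : realType} {d : nat}.
Local Open Scope ereal_scope.
Import HBNNSimple.

(** [has_density] is the case of indicators. Finite sums give simple functions, and monotone
    convergence along [nnsfun_approx] on both sides gives every nonnegative measurable [g]. *)
Lemma density_integral (nu : {measure set 'rV[R]_d -> \bar R}) k
    (g : 'rV[R]_d -> \bar R) :
  has_density nu k -> measurable_fun setT g -> (forall x, 0 <= g x) ->
  \int[nu]_x g x = \int[lebesgue_rV d]_x (g x * (k x)%:E).
Proof.
move=> [mk k0 nuE] mg g0.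
have mkE : measurable_fun setT (EFin \o k) by exact/measurable_EFinP.
pose g_ := nnsfun_approx measurableT mg.
transitivity (limn (fun n => \int[nu]_x (g_ n x)%:E)).
  rewrite -monotone_convergence//.
  - by apply: eq_integral => x _; apply/esym/cvg_lim => //; exact: cvg_nnsfun_approx.
  - by move=> n; exact/measurable_EFinP.
  - by move=> n y _; rewrite lee_fin.
  - by move=> y _ m n mn; rewrite lee_fin; exact/lefP/nd_nnsfun_approx.
rewrite [X in limn X](_ : _ =
    (fun n => \int[lebesgue_rV d]_x ((g_ n x)%:E * (k x)%:E))).
  rewrite -monotone_convergence//; last 3 first.
    - by move=> n; apply: emeasurable_funM => //; exact/measurable_EFinP.
    - by move=> n x _; rewrite mule_ge0 // lee_fin.
    - move=> x _ m n mn; rewrite lee_wpmul2r ?lee_fin //; exact/lefP/nd_nnsfun_approx.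
  apply: eq_integral => x _; apply/cvg_lim => //.
  apply: cvgeZr => //; exact: cvg_nnsfun_approx.
apply/funext => n.
transitivity (\sum_(r \in range (g_ n))
    \int[lebesgue_rV d]_x ((r * \1_(g_ n @^-1` [set r]) x)%:E * (k x)%:E)).
  under eq_integral do rewrite fimfunE -fsumEFin//.
  rewrite ge0_integral_fsum//; last 2 first.
  - by move=> y; exact/measurable_EFinP/measurable_funM.
  - by move=> y x _; rewrite nnfun_muleindic_ge0.
  apply: eq_fsbigr => r _; rewrite integralZl_indic_nnsfun// integral_indic//= setIT.
  rewrite nuE // integral_mkcond.
  (* The approximants are nonnegative, so a negative value [r] has an empty fibre and contributes
     zero on both sides. *)
  have [r0|r0] := leP 0%R r; last first.
    rewrite preimage_nnfun0 // [X in _ * X]integral0_eq ?mule0; last first.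
      by move=> x _; rewrite patchE in_set0.
    by rewrite integral0_eq // => x _; rewrite indic0 mulr0 mul0e.
  rewrite -ge0_integralZl//; last 2 first.
  - apply/(measurable_restrictT _ _).1 => //; exact: measurable_funTS.
  - by move=> x _; apply: erestrict_ge0 => y _; rewrite lee_fin.
  apply: eq_integral => x _; rewrite patchE indicE.
  by case: ifP => _; rewrite ?mulr1 ?mulr0 ?mule0 ?mul0e.
rewrite -ge0_integral_fsum//.
- apply: eq_integral => x _; rewrite [in RHS]fimfunE -fsumEFin//.
  rewrite ge0_mule_fsuml // => r; exact: nnfun_muleindic_ge0.
- move=> r; apply: emeasurable_funM => //; exact/measurable_EFinP/measurable_funM.
- move=> r x _; rewrite mule_ge0 // ?lee_fin //; exact: nnfun_muleindic_ge0.
Qed.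

End density.

(** * Scaling of the radial profile *)

(** The index condition supplies an admissible exponent [a > - d - 1]. Read backwards, it bounds
    [phi s] by [K0 * (t / s) ^ b * phi t] with [b < d + 1], and [q = 2 ^ (b - d)] is the excess over
    [2 ^ d] per doubling of the scale. *)
Lemma lower_matuszewska0_growth (R : realType) (d : nat) (phi : R -> R) :
  (forall t, 0 < t -> 0 < phi t) ->
  ((- d%:R - 1)%:E < lower_matuszewska0 phi)%E ->
  exists q K R0 : R, [/\ 1 < q < 2, 1 <= K, 0 < R0,
    forall (m : nat) s, 0 < s -> 2 ^+ m * s < R0 ->
      phi s <= K * (2 ^+ d * q) ^+ m * phi (2 ^+ m * s) &
    forall s t, 0 < s -> s <= t <= 8 * s -> t < R0 -> phi s <= K * phi t].
Proof.
move=> phi0 /ereal_sup_gt[_ [a [A [R0 [A0 R00 Aphi]] <-]]].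
rewrite lte_fin => da.
(* An exponent [- b] below [a] is still admissible because [t / s >= 1]. The maximum with [d + 1/2]
   forces [q > 1], which the geometric sums in the lower bound need. *)
pose b := Num.max (- a) (d%:R + 2^-1).
have bd : d%:R + 2^-1 <= b by rewrite le_max lexx orbT.
have b1 : b < d%:R + 1 by rewrite gt_max; apply/andP; split; lra.
have ab : - b <= a by rewrite lerNl le_max lexx.
pose K0 := Num.max A^-1 1.
have K01 : 1 <= K0 by rewrite le_max lexx orbT.
have growth s t : 0 < s -> s <= t -> t < R0 ->
    phi s <= K0 * (t / s) `^ b * phi t.
  move=> s0; rewrite le_eqVlt => /predU1P[<-|st] tR0.
    by rewrite divff ?gt_eqF // powR1 mulr1 ler_peMl // ltW // phi0.
  have t0 := lt_trans s0 st.
  have ts : 1 <= t / s by rewrite ler_pdivlMr // mul1r ltW.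
  have ts0 : 0 < (t / s) `^ b by rewrite powR_gt0 // (lt_le_trans ltr01).
  have : A / (t / s) `^ b <= phi t / phi s.
    rewrite -powRN; apply: le_trans (Aphi s t s0 st tR0).
    by rewrite ler_pM2l //; exact: ler_powR.
  rewrite ler_pdivlMr ?phi0 // mulrAC ler_pdivrMr // => H.
  apply: (@le_trans _ _ (A^-1 * (t / s) `^ b * phi t)).
    by rewrite -mulrA ler_pdivlMl // [leRHS]mulrC.
  rewrite ler_wpM2r ?(ltW (phi0 _ _)) // ler_wpM2r ?(ltW ts0) //.
  by rewrite le_max lexx.
have b0 : 0 <= b by apply: le_trans bd; rewrite addr_ge0.
pose q := 2 `^ (b - d%:R) : R.
have q2 : 2 `^ b = 2 ^+ d * q.
  rewrite -powR_mulrn // -powRD; last by rewrite pnatr_eq0 implybT.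
  by rewrite addrC subrK.
(* The factor [8 ^ b] absorbs [(t / s) ^ b] for [t <= 8 * s]; being at least 1, it does no harm in
   the first estimate. *)
exists q, (K0 * 8 `^ b), R0.
have h8 : 1 <= 8 `^ b :> R.
  by rewrite -[leLHS](powRr0 8); apply: ler_powR; rewrite // ler1n.
split => //.
- have two_gt1 e : 0 < e -> 1 < 2 `^ e :> R.
    move=> e0; suff: 1 `^ e < 2 `^ e :> R by rewrite powR1.
    by apply: gt0_ltr_powR; rewrite ?nnegrE // ltr1n.
  rewrite two_gt1 /=; last by lra.
  have two_prod : 2 = q * 2 `^ (1 - (b - d%:R)).
    by rewrite -powRD ?pnatr_eq0 ?implybT // addrC subrK powRr1.
  by rewrite [ltRHS]two_prod ltr_pMr ?powR_gt0 // two_gt1 //; lra.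
- by rewrite -[leLHS]mulr1; apply: ler_pM.
- move=> m s s0 msR0.
  have s2 : s <= 2 ^+ m * s by rewrite ler_peMl ?(ltW s0) // exprn_ege1 // ler1n.
  apply: le_trans (growth _ _ s0 s2 msR0) _.
  have -> : (2 ^+ m * s / s) `^ b = (2 ^+ d * q) ^+ m.
    rewrite mulfK ?gt_eqF // -(powR_mulrn m (ler0n _ 2)) -powRrM mulrC powRrM q2.
    by rewrite powR_mulrn // mulr_ge0 ?powR_ge0 // exprn_ge0.
  have q0 : 0 <= 2 ^+ d * q by rewrite mulr_ge0 ?powR_ge0 // exprn_ge0.
  rewrite ler_wpM2r ?(ltW (phi0 _ _)) ?(lt_le_trans s0) // ler_wpM2r ?exprn_ge0 //.
  by rewrite ler_peMr // (le_trans ler01).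
- move=> s t s0 /andP[st t8] tR0.
  apply: le_trans (growth _ _ s0 st tR0) _.
  have t0 := lt_le_trans s0 st.
  rewrite ler_wpM2r ?(ltW (phi0 _ _)) // ler_wpM2l ?(le_trans ler01) //.
  by apply: ge0_ler_powR; rewrite ?nnegrE ?divr_ge0 ?(ltW s0) ?(ltW t0) // ler_pdivrMr.
Qed.

Lemma dyadic_bracket (R : realType) (a b : R) : 0 < a -> a < b ->
  exists m, 2 ^+ m * a < b <= 2 ^+ m.+1 * a.
Proof.
move=> a0 ab.
have ex : exists n, b <= 2 ^+ n * a.
  exists (Num.truncn (b / a)).+1; rewrite -ler_pdivrMr //.
  apply: ltW; apply: lt_trans (truncnS_gt _) _.
  by rewrite -natrX ltr_nat ltn_expl.
case: (ex_minnP ex) => -[|m] bm mmin.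
  by move: bm; rewrite expr0 mul1r leNgt ab.
exists m; rewrite bm andbT ltNge; apply/negP => /mmin.
by rewrite ltnn.
Qed.

Lemma dyadic_bracket_le (R : realType) (n : nat) (a b : R) : a <= b -> b < 2 ^+ n * a ->
  exists2 m, (m < n)%N & 2 ^+ m * a <= b < 2 ^+ m.+1 * a.
Proof.
move=> ab; elim: n => [|n IH] bn; first by move: bn; rewrite expr0 mul1r ltNge ab.
have [/IH[m mn H]|nb] := ltP b (2 ^+ n * a); first by exists m => //; exact: ltnW.
by exists n; rewrite // nb bn.
Qed.

(** * Dyadic bound on h_p *)

Section hfun_bound.
Context {R : realType} {d : nat}.
Variables (p : R) (p_ge1 : 1 <= p).
Variables (nu : {measure set 'rV[R]_d -> \bar R}).
Implicit Types h : 'rV[R]_d.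

Definition hweight (r : R) h : R := Num.min 1 (enorm h `^ p / r `^ p).

Lemma hweight_ge0 r h : 0 <= hweight r h.
Proof. by rewrite le_min ler01 divr_ge0 ?powR_ge0. Qed.

Lemma hweight_le1 r h : hweight r h <= 1.
Proof. by rewrite ge_min lexx. Qed.

Lemma powR_divE (a b : R) : 0 <= a -> 0 <= b -> (a / b) `^ p = a `^ p / b `^ p.
Proof.
move=> a0 b0; rewrite powRM ?invr_ge0 //; congr (_ * _).
by rewrite -powR_inv1 // powRAC powR_inv1 ?powR_ge0.
Qed.

(** For [p >= 1] a [p]-th power of a number in [[0, 1]] is at most that number. This linear decay
    gives the weight [2 ^- m] on the [m]-th inner shell, enough against a growth [q ^ m] with
    [q < 2]. *)
Lemma hweight_ball r h : 0 < r -> enorm h <= r -> hweight r h <= enorm h / r.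
Proof.
move=> r0 hr; rewrite /hweight -powR_divE ?enorm_ge0 ?(ltW r0) //.
rewrite ge_min; apply/orP; right.
have [->|h0] := eqVneq (enorm h) 0.
  by rewrite mul0r powR0 // gt_eqF // (lt_le_trans ltr01).
have hpos : 0 < enorm h by rewrite lt_def h0 enorm_ge0.
by apply: ge1r_powR => //; rewrite divr_gt0 //= ler_pdivrMr // mul1r.
Qed.

Lemma hweight_out r h : 0 < r -> r <= enorm h -> hweight r h = 1.
Proof.
move=> r0 rh; apply/min_idPl; rewrite ler_pdivlMr ?powR_gt0 // mul1r.
by apply: ge0_ler_powR; rewrite ?nnegrE ?enorm_ge0 ?(ltW r0) // (le_trans ler01).
Qed.

Lemma measurable_hweight r : measurable_fun setT (hweight r).
Proof.
apply: measurable_minr => //; apply: measurable_funM => //.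
exact: (measurableT_comp (@measurable_powR R p) measurable_enorm).
Qed.

Lemma measurable_hweightE r : measurable_fun setT (EFin \o hweight r).
Proof. by apply/measurable_EFinP; exact: measurable_hweight. Qed.

Lemma hfun_le r s : 0 < r -> r <= s -> (hfun nu p s <= hfun nu p r)%E.
Proof.
move=> r0 rs; apply: ge0_le_integral => //.
- by move=> h _; rewrite lee_fin hweight_ge0.
- exact: measurable_hweightE.
- exact: measurable_hweightE.
move=> h _; rewrite lee_fin le_min ge_min lexx /= ge_min; apply/orP; right.
have p0 : 0 <= p by exact: le_trans p_ge1.
have s0 := lt_le_trans r0 rs.
apply: ler_wpM2l; first exact: powR_ge0.
rewrite lef_pV2 ?posrE ?powR_gt0 //.
by apply: ge0_ler_powR; rewrite ?nnegrE ?(ltW r0) ?(ltW s0).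
Qed.

Lemma hfun_lty r : 0 < r ->
  (\int[nu]_x (Num.min 1 (enorm x `^ p))%:E < +oo)%E -> (hfun nu p r < +oo)%E.
Proof.
move=> r0 nu_int; set c := Num.max 1 (r `^ p)^-1.
have mw : measurable_fun setT
    (fun x : 'rV[R]_d => (Num.min 1 (enorm x `^ p))%:E).
  apply/measurable_EFinP; apply: measurable_minr => //.
  exact: (measurableT_comp (@measurable_powR R p) measurable_enorm).
have w0 (x : 'rV[R]_d) : 0 <= Num.min 1 (enorm x `^ p).
  by rewrite le_min ler01 powR_ge0.
apply: (@le_lt_trans _ _ (\int[nu]_x (c%:E * (Num.min 1 (enorm x `^ p))%:E))%E).
  apply: ge0_le_integral => //.
  - by move=> h _; rewrite lee_fin hweight_ge0.
  - exact: measurable_hweightE.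
  - by apply: emeasurable_funM.
  move=> h _; rewrite -EFinM lee_fin.
  have c1 : 1 <= c by rewrite le_max lexx.
  have c2 : (r `^ p)^-1 <= c by rewrite le_max lexx orbT.
  have [h1|h1] := leP 1 (enorm h `^ p).
    by rewrite mulr1 ge_min c1.
  apply: (@le_trans _ _ (enorm h `^ p / r `^ p)); first by rewrite ge_min lexx orbT.
  by rewrite mulrC ler_wpM2r // powR_ge0.
rewrite ge0_integralZl_EFin //; last 2 first.
- by move=> x _; rewrite lee_fin.
- by rewrite le_max ler01.
by rewrite lte_mul_pinfty // ?lee_fin ?le_max ?ler01.
Qed.

Definition shell (s : R) : set 'rV[R]_d := [set h | s <= enorm h < 2 * s].

Lemma measurable_shell s : measurable (shell s).
Proof.
rewrite (_ : shell s = @enorm R d @^-1` `[s, 2 * s[%classic).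
  by rewrite -[X in measurable X]setTI; apply: measurable_enorm.
by apply/seteqP; split=> h /=; rewrite in_itv.
Qed.

Variables (k : 'rV[R]_d -> R) (k_density : has_density nu k).
Variables (phi : R -> R) (phi_gt0 : forall t : R, 0 < t -> 0 < phi t).
Hypothesis k_radial : has_radial_profile k phi.

(** The shell avoids the origin, so its density is given by [phi], and it lies in a cube of
    half-side [2 * s]. *)
Lemma measure_shell_le s C : 0 < s -> (forall t, s <= t < 2 * s -> phi t <= C) ->
  (nu (shell s) <= (C * (4 * s) ^+ d)%:E)%E.
Proof.
move=> s0 phiC; have [mk k0 nuE] := k_density.
have C0 : 0 <= C.
  apply: (@le_trans _ _ (phi s)); first exact/ltW/phi_gt0.
  by apply: phiC; rewrite lexx /=; lra.
have ms := measurable_shell s.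
rewrite nuE //.
apply: (@le_trans _ _ (\int[lebesgue_rV d]_(x in shell s) C%:E)%E).
  apply: ge0_le_integral => //.
  - by move=> h _; rewrite lee_fin.
  - exact/measurable_EFinP/measurable_funTS.
  move=> h /= hs; rewrite lee_fin k_radial; first exact: phiC.
  by apply: enorm_neq0; case/andP: hs => + _; exact: lt_le_trans.
rewrite integral_cst // EFinM lee_wpmul2l ?lee_fin //.
have e : (2 * (2 * s)) ^+ d = (4 * s) ^+ d by congr (_ ^+ _); ring.
rewrite -e -(@lebesgue_cube R d 0); last by rewrite mulr_ge0 // ltW.
apply: le_measure; rewrite ?inE //; first exact: measurable_cube.
move=> h /= /andP[_ hs] i; rewrite mxE subr0.
exact: le_lt_trans (ler_coord_enorm h i) hs.
Qed.

Variables (q K R0 : R) (q12 : 1 < q < 2) (K_ge1 : 1 <= K).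
Hypothesis growth : forall (m : nat) s, 0 < s -> 2 ^+ m * s < R0 ->
  phi s <= K * (2 ^+ d * q) ^+ m * phi (2 ^+ m * s).
Hypothesis doubling : forall s t, 0 < s -> s <= t <= 8 * s -> t < R0 ->
  phi s <= K * phi t.

Lemma measure_shell s : 0 < s -> 2 * s < R0 ->
  (nu (shell s) <= (K * phi (2 * s) * (4 * s) ^+ d)%:E)%E.
Proof.
move=> s0 sR; apply: measure_shell_le => // t /andP[st ts].
apply: doubling => //; [exact: lt_le_trans st | apply/andP; split; lra].
Qed.

(** The inner shells are numbered from the outside: [low r 0] is the one just inside radius [r]. *)
Let low (r : R) (m : nat) := shell (2 ^- m.+1 * r).

(** Passing from the scale [2 ^- m * r] to [2 * r] costs [(2 ^ d * q) ^ (m + 1)], and the volume of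
    the shell gives back [2 ^- (d * m)]; only [q ^ m] and a constant remain. *)
Lemma measure_low r m : 0 < r -> 2 * r < R0 ->
  (nu (low r m) <=
   ((K ^+ 2 * 4 ^+ d * q * phi (2 * r) * r ^+ d) * q ^+ m)%:E)%E.
Proof.
move=> r0 rR.
have e2 : (2 : R) != 0 by rewrite pnatr_eq0.
have s0 : 0 < 2 ^- m * r by rewrite mulr_gt0 // invr_gt0 exprn_gt0.
have e : 2 * (2 ^- m.+1 * r) = 2 ^- m * r.
  by rewrite exprS invfM !mulrA divff // mul1r.
have p2 : phi (2 ^- m * r) <= K * (2 ^+ d * q) ^+ m.+1 * phi (2 * r).
  have e' : 2 ^+ m.+1 * (2 ^- m * r) = 2 * r.
    by rewrite exprS mulrA mulrK // unitfE expf_neq0.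
  by rewrite -e'; apply: growth => //; rewrite e'.
have hs0 : 0 < 2 ^- m.+1 * r by rewrite mulr_gt0 // invr_gt0 exprn_gt0.
have hs1 : 2 ^- m * r <= r.
  by rewrite ler_piMl ?(ltW r0) // invf_le1 ?exprn_gt0 // exprn_ege1 // ler1n.
apply: le_trans (measure_shell hs0 _) _; first by rewrite e; lra.
rewrite lee_fin e.
have -> : 4 * (2 ^- m.+1 * r) = 2 * (2 ^- m * r) by rewrite -e; ring.
have K0 : 0 <= K by exact: le_trans K_ge1.
apply: (@le_trans _ _ (K * (K * (2 ^+ d * q) ^+ m.+1 * phi (2 * r)) *
    (2 * (2 ^- m * r)) ^+ d)).
  rewrite ler_wpM2r ?exprn_ge0 ?(mulr_ge0 _ (ltW s0)) //.
  by rewrite ler_wpM2l.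
rewrite le_eqVlt; apply/orP; left; apply/eqP.
rewrite !exprMn !exprS -exprVn -!exprM mulnC.
have : 2 ^+ (d * m) * 2^-1 ^+ (d * m) = 1 :> R.
  by rewrite -exprMn divff // expr1n.
rewrite (_ : 4 ^+ d = 2 ^+ d * 2 ^+ d); last by rewrite -exprMn; congr (_ ^+ _); ring.
rewrite [(m * d)%N]mulnC expr0.
move: (2 ^+ (d * m)) (2^-1 ^+ (d * m)) => u v uv.
transitivity ((K * (K * 1) * (2 ^+ d * 2 ^+ d) * q * phi (2 * r) * r ^+ d * q ^+ m) * (u * v)).
  by ring.
by rewrite uv; ring.
Qed.

(** Each [h] is paid for by one term: an inner shell if [enorm h < r], an outer shell if
    [enorm h < 2 ^ (N + 1) * r], and beyond that [hweight rho h = 1]. The origin lies in no shell,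
    but the weight vanishes there. *)
Lemma hweight_shells r rho N h : 0 < r -> rho <= 2 ^+ N.+1 * r -> 0 < rho ->
  ((hweight r h)%:E <= (hweight rho h)%:E +
    (\sum_(m <oo) (2 ^- m * \1_(low r m) h)%:E +
    \sum_(i < N.+1) (\1_(shell (2 ^+ i * r)) h)%:E))%E.
Proof.
move=> r0 rhoN rho0.
have low0 : (0 <= \sum_(m <oo) (2 ^- m * \1_(low r m) h)%:E :> \bar R)%E.
  by apply: nneseries_ge0 => m _ _; rewrite lee_fin mulr_ge0 // invr_ge0 exprn_ge0.
have up0 : (0 <= \sum_(i < N.+1) (\1_(shell (2 ^+ i * r)) h)%:E :> \bar R)%E.
  by apply: sume_ge0 => i _; rewrite lee_fin.
have w0 : (0 <= (hweight rho h)%:E)%E by rewrite lee_fin hweight_ge0.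
have [h0|hn0] := eqVneq (enorm h) 0.
  rewrite (le_trans _ (adde_ge0 w0 (adde_ge0 low0 up0))) // lee_fin.
  by apply: le_trans (hweight_ball r0 _) _; rewrite h0 ?mul0r // ltW.
have hpos : 0 < enorm h by rewrite lt_def hn0 enorm_ge0.
have [hr|rh] := ltP (enorm h) r.
  have [m /andP[mlo mhi]] := dyadic_bracket hpos hr.
  have p2 : 0 < 2 ^+ m :> R by exact: exprn_gt0.
  have p2' : 0 < 2 ^+ m.+1 :> R by exact: exprn_gt0.
  have hin : low r m h.
    apply/andP; split; first by rewrite ler_pdivrMl.
    rewrite exprS invfM !mulrA divff ?pnatr_eq0 // mul1r.
    by rewrite ltr_pdivlMl.
  apply: (@le_trans _ _ (2 ^- m)%:E).
    rewrite lee_fin; apply: le_trans (hweight_ball r0 (ltW hr)) _.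
    by rewrite ler_pdivrMr // ler_pdivlMl // ltW.
  apply: (@le_trans _ _ (\sum_(m <oo) (2 ^- m * \1_(low r m) h)%:E)%E); last first.
    by rewrite addeCA leeDl // adde_ge0.
  have nn i : xpredT i -> (0 <= i)%N -> (0 <= (2 ^- i * \1_(low r i) h)%:E :> \bar R)%E.
    by move=> _ _; rewrite lee_fin mulr_ge0 // invr_ge0 exprn_ge0.
  apply: le_trans (nneseries_lim_ge m.+1 _); last by move=> i _ _; exact: nn.
  rewrite big_nat_recr //= indicE mem_set // mulr1 leeDr // sume_ge0 // => i _.
have [hN|Nh] := ltP (enorm h) (2 ^+ N.+1 * r).
  have [i iN hi] := dyadic_bracket_le rh hN.
  apply: (@le_trans _ _ 1%E); first by rewrite lee_fin hweight_le1.
  apply: (@le_trans _ _ (\sum_(i < N.+1) (\1_(shell (2 ^+ i * r)) h)%:E)%E); last first.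
    by rewrite addeA leeDr // adde_ge0.
  rewrite (bigD1 (Ordinal iN)) //= indicE mem_set; last first.
    by rewrite /shell /= mulrA -exprS.
  by rewrite leeDl // sume_ge0 // => j _; rewrite lee_fin.
rewrite (hweight_out rho0) ?(le_trans rhoN) //.
apply: (@le_trans _ _ 1%E); first by rewrite lee_fin hweight_le1.
by rewrite leeDl // adde_ge0.
Qed.

(** Integrating [hweight_shells], the inner shells form a geometric series of ratio [q / 2 < 1], so
    together they cost no more than a multiple of the term [i = 0]. The outer shells are compared
    term by term. *)
Lemma hfun_dyadic : exists2 C, 0 < C & forall r rho (N : nat),
  0 < r -> 0 < rho -> rho <= 2 ^+ N.+1 * r -> 2 ^+ N.+1 * r < R0 ->
  (hfun nu p r <= hfun nu p rho +
    (C * \sum_(i < N.+1) (2 ^+ i * r) ^+ d * phi (2 ^+ i.+1 * r))%:E)%E.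
Proof.
have K0 : 0 < K by exact: lt_le_trans K_ge1.
have [q0 q2] : 0 < q /\ q < 2.
  by case/andP: q12 => q1 ->; split => //; exact: lt_trans q1.
(* [C1] pays for all inner shells, [C2] below for the outer ones. *)
pose C1 := K ^+ 2 * 4 ^+ d * q / (1 - q / 2).
have C10 : 0 < C1 by rewrite !mulr_gt0 ?exprn_gt0 // invr_gt0; lra.
pose C2 := K * 4 ^+ d.
have C20 : 0 < C2 by rewrite mulr_gt0 ?exprn_gt0.
exists (C1 + C2); first exact: addr_gt0.
move=> r rho N r0 rho0 rhoN NR.
have rR : 2 * r < R0.
  apply: le_lt_trans NR; rewrite ler_pM2r // exprS ler_peMr //.
  by rewrite exprn_ege1 // ler1n.
set S := \sum_(i < N.+1) _.
have mlow m : measurable_fun setT (fun h => (2 ^- m * \1_(low r m) h)%:E : \bar R).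
  apply/measurable_EFinP; apply: measurable_funM => //.
  by apply: measurable_indic; exact: measurable_shell.
have mup (i : nat) : measurable_fun setT (fun h => (\1_(shell (2 ^+ i * r)) h)%:E : \bar R).
  by apply/measurable_EFinP; apply: measurable_indic; exact: measurable_shell.
have low0 m h : (0 <= (2 ^- m * \1_(low r m) h)%:E :> \bar R)%E.
  by rewrite lee_fin mulr_ge0 // invr_ge0 exprn_ge0.
have mseries : measurable_fun setT
    (fun h => \sum_(m <oo) (2 ^- m * \1_(low r m) h)%:E : \bar R)%E.
  by apply: ge0_emeasurable_sum => // m x _ _; exact: low0.
have msum : measurable_fun setT
    (fun h => \sum_(i < N.+1) (\1_(shell (2 ^+ i * r)) h)%:E : \bar R)%E.
  by apply: emeasurable_sum => i _; exact: mup.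
have up0 h : (0 <= \sum_(i < N.+1) (\1_(shell (2 ^+ i * r)) h)%:E :> \bar R)%E.
  by apply: sume_ge0 => i _; rewrite lee_fin.
have series0 h : (0 <= \sum_(m <oo) (2 ^- m * \1_(low r m) h)%:E :> \bar R)%E.
  by apply: nneseries_ge0 => m _ _; exact: low0.
apply: le_trans.
  apply: ge0_le_integral; last by move=> h _; exact: (hweight_shells h r0 rhoN rho0).
  - by [].
  - by move=> h _; rewrite lee_fin hweight_ge0.
  - exact: measurable_hweightE.
  - apply: emeasurable_funD; first exact: measurable_hweightE.
    exact: emeasurable_funD.
rewrite ge0_integralD //; last 4 first.
- by move=> h _; rewrite lee_fin hweight_ge0.
- exact: measurable_hweightE.
- by move=> h _; exact: adde_ge0.
- exact: emeasurable_funD.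
rewrite leeD2l // ge0_integralD //.
rewrite mulrDl EFinD; apply: leeD.
  rewrite integral_nneseries //.
  apply: (@le_trans _ _ (\sum_(m <oo)
      ((K ^+ 2 * 4 ^+ d * q * phi (2 * r) * r ^+ d) * (q / 2) ^+ m)%:E)%E).
    apply: lee_nneseries => [m _ _|m _]; first by apply: integral_ge0 => h _; exact: low0.
    under eq_integral do rewrite EFinM.
    have ml : measurable (low r m) by exact: measurable_shell.
    have i2 : 0 <= 2 ^- m :> R by rewrite invr_ge0 exprn_ge0.
    rewrite ge0_integralZl_EFin //; last first.
      by apply/measurable_EFinP; apply: measurable_indic.
    rewrite integral_indic // setIT.
    apply: (@le_trans _ _ ((2 ^- m)%:E *
        ((K ^+ 2 * 4 ^+ d * q * phi (2 * r) * r ^+ d) * q ^+ m)%:E)%E).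
      by rewrite lee_wpmul2l ?lee_fin //; exact: measure_low.
    by rewrite -EFinM lee_fin expr_div_n mulrC mulrA.
  set a := K ^+ 2 * _ * _ * _ * _.
  have q1 : `|q / 2| < 1 by rewrite ger0_norm ?divr_ge0 ?ltW //; lra.
  have -> : (\sum_(m <oo) (a * (q / 2) ^+ m)%:E = (a / (1 - q / 2))%:E)%E.
    apply/cvg_lim => //.
    rewrite [X in X @ _](_ : _ = EFin \o series (geometric a (q / 2))).
      by apply: cvg_EFin; [exact: nearW|exact: cvg_geometric_series].
    by apply/funext => n /=; rewrite /series /= sumEFin.
  rewrite lee_fin (_ : a / (1 - q / 2) = C1 * (phi (2 * r) * r ^+ d)); last first.
    by rewrite /a /C1; ring.
  apply: ler_wpM2l; first exact: ltW.
  rewrite /S big_ord_recl /= expr0 mul1r expr1 mulrC lerDl sumr_ge0 // => i _.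
  by rewrite ltW // mulr_gt0 ?exprn_gt0 ?phi_gt0 // mulr_gt0 ?exprn_gt0.
rewrite ge0_integral_sum //.
rewrite mulr_sumr -sumEFin; apply: lee_sum => i _.
have ms : measurable (shell (2 ^+ i * r)) by exact: measurable_shell.
rewrite integral_indic // setIT.
have s0 : 0 < 2 ^+ i * r by rewrite mulr_gt0 // exprn_gt0.
have sR : 2 * (2 ^+ i * r) < R0.
  apply: le_lt_trans NR; rewrite mulrA -exprS ler_pM2r //.
  by rewrite ler_weXn2l ?ler1n // ltn_ord.
apply: le_trans (measure_shell s0 sR) _.
rewrite lee_fin mulrA -exprS exprMn /C2 le_eqVlt; apply/orP; left; apply/eqP.
by ring.
Qed.

End hfun_bound.

(** * Energies and the upper bound *)

Section sobolev.
Context {R : realType} {d : nat}.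
Variables (p : R) (p_ge1 : 1 <= p) (nu : {measure set 'rV[R]_d -> \bar R}).
Implicit Types (f : 'rV[R]_d -> R).
Local Open Scope ereal_scope.

(** [lp_mass] and [gagliardo] are the [p]-th powers of the norm and of the seminorm. The estimates
    are made for them and carried over to [sobolev_norm] at the end. *)
Definition lp_mass f : \bar R := \int[lebesgue_rV d]_x (`|f x| `^ p)%:E.

Definition gagliardo f : \bar R :=
  \int[nu]_h \int[lebesgue_rV d]_x (`|f (x + h) - f x| `^ p)%:E.

Let p_gt0 : (0 < p)%R. Proof. exact: lt_le_trans p_ge1. Qed.

Lemma lp_mass_ge0 f : 0 <= lp_mass f.
Proof. by apply: integral_ge0 => x _; rewrite lee_fin powR_ge0. Qed.

Lemma gagliardo_ge0 f : 0 <= gagliardo f.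
Proof.
by apply: integral_ge0 => h _; apply: integral_ge0 => x _; rewrite lee_fin powR_ge0.
Qed.

Lemma Lnorm_lp_mass f : 'N[lebesgue_rV d]_p%:E[EFin \o f] = lp_mass f `^ p^-1.
Proof.
rewrite unlock /lp_mass; congr (_ `^ _); exact: eq_integral.
Qed.

Lemma poweR_invK (a : \bar R) : 0 <= a -> (a `^ p^-1) `^ p = a.
Proof. by move=> a0; rewrite -poweRrM mulVf ?gt_eqF // poweRe1. Qed.

Lemma lee_poweR (a b : \bar R) : 0 <= a -> a <= b -> a `^ p <= b `^ p.
Proof.
move=> a0 ab; apply: gt0_ler_poweR => //; first exact: ltW.
- by rewrite in_itv /= a0 leey.
- by rewrite in_itv /= (le_trans a0 ab) leey.
Qed.

Lemma lp_mass_le_norm f : lp_mass f <= sobolev_norm nu p f `^ p.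
Proof.
rewrite -[leLHS]poweR_invK ?lp_mass_ge0 //.
by apply: lee_poweR; rewrite ?poweR_ge0 // /sobolev_norm Lnorm_lp_mass leeDl ?poweR_ge0.
Qed.

Lemma gagliardo_le_norm f : gagliardo f <= sobolev_norm nu p f `^ p.
Proof.
rewrite -[leLHS]poweR_invK ?gagliardo_ge0 //.
by apply: lee_poweR; rewrite ?poweR_ge0 // /sobolev_norm Lnorm_lp_mass leeDr ?poweR_ge0.
Qed.

(** The sum of the two [p]-th roots is at most twice the larger one, whose [p]-th power is one of
    the two summands on the right. *)
Lemma sobolev_norm_le f :
  sobolev_norm nu p f `^ p <= (2 `^ p)%:E * (lp_mass f + gagliardo f).
Proof.
rewrite /sobolev_norm Lnorm_lp_mass /sobolev_seminorm -/(gagliardo f).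
set a := lp_mass f; set b := gagliardo f.
have a0 : 0 <= a := lp_mass_ge0 f.
have b0 : 0 <= b := gagliardo_ge0 f.
pose c := Order.max (a `^ p^-1) (b `^ p^-1).
have c0 : 0 <= c by rewrite le_max poweR_ge0.
apply: (@le_trans _ _ ((2%:E * c) `^ p)).
  apply: lee_poweR; first by rewrite adde_ge0 ?poweR_ge0.
  rewrite mule_natl mule2n; apply: leeD; rewrite le_max lexx ?orbT //.
rewrite poweRM // poweR_EFin lee_wpmul2l ?lee_fin ?powR_ge0 //.
rewrite /c; case: (leP (a `^ p^-1) (b `^ p^-1)) => _; rewrite poweR_invK //.
  by rewrite leeDr.
by rewrite leeDl.
Qed.

Lemma measurable_increment f : measurable_fun setT f ->
  measurable_fun setT (fun hx : 'rV[R]_d * 'rV[R]_d =>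
    (`|f (hx.2 + hx.1) - f hx.2| `^ p)%:E).
Proof.
move=> mf; apply/measurable_EFinP.
apply: (measurableT_comp (@measurable_powR R p)).
apply: (measurableT_comp (@normr_measurable R setT)).
apply: measurable_funB.
  exact: (measurableT_comp mf measurable_add_rV).
exact: (measurableT_comp mf measurable_snd).
Qed.

Lemma measurable_increment_integral f : measurable_fun setT f ->
  measurable_fun setT (fun h : 'rV[R]_d =>
    \int[lebesgue_rV d]_x (`|f (x + h) - f x| `^ p)%:E).
Proof.
move=> mf.
apply: (measurable_fun_fubini_tonelli_F (m2 := lebesgue_rV d) (fun hx : 'rV[R]_d * 'rV[R]_d =>
    (`|f (hx.2 + hx.1) - f hx.2| `^ p)%:E)); first exact: measurable_increment.
by move=> hx; rewrite lee_fin powR_ge0.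
Qed.

End sobolev.

Lemma maxr_lipschitz (R : realType) (c a b : R) :
  `|Num.max c a - Num.max c b| <= `|a - b|.
Proof.
have := ler_norm (a - b); have := ler_norm (b - a); rewrite [`|b - a|]distrC ler_norml.
rewrite /Num.max; move: `|a - b| => e *.
by case: (ltP c a) => ?; case: (ltP c b) => ?; apply/andP; split; lra.
Qed.

Lemma minr_lipschitz (R : realType) (c a b : R) :
  `|Num.min c a - Num.min c b| <= `|a - b|.
Proof.
have := ler_norm (a - b); have := ler_norm (b - a); rewrite [`|b - a|]distrC ler_norml.
rewrite /Num.min; move: `|a - b| => e *.
by case: (ltP c a) => ?; case: (ltP c b) => ?; apply/andP; split; lra.
Qed.

Lemma powR_le1 (R : realType) (a p : R) : 0 <= p -> 0 <= a <= 1 -> a `^ p <= 1.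
Proof.
move=> p0 /andP[a0 a1]; suff: a `^ p <= 1 `^ p by rewrite powR1.
by apply: ge0_ler_powR; rewrite ?nnegrE.
Qed.

(** * The cutoff function and the upper bound *)

Section upper_bound.
Context {R : realType} {d : nat}.
Variables (p : R) (p_ge1 : 1 <= p) (nu : {measure set 'rV[R]_d -> \bar R}).
Implicit Types x y h : 'rV[R]_d.

Lemma normr_rV_enorm x : `|x| <= enorm x.
Proof.
rewrite /Num.norm /= mx_normrE; apply: bigmax_le; first exact: enorm_ge0.
by move=> [i j] _ /=; rewrite (ord1 i) ler_coord_enorm.
Qed.

Lemma ler_coord_norm x i : `|x ord0 i| <= `|x|.
Proof.
rewrite {2}/Num.norm /= mx_normrE.
exact: (le_bigmax _ (fun ij => `|x ij.1 ij.2|) (ord0, i)).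
Qed.

Lemma measurable_normB x : measurable_fun setT (fun y => `|y - x|).
Proof.
have mnorm : measurable_fun setT (fun y : 'rV[R]_d => `|y|).
  apply: (measurability _ (RGenOpens.measurableE R)).
  move=> _ [_ [a [b ->] <-]]; rewrite setTI; apply: open_measurable_rV.
  have /continuousP := @norm_continuous R 'rV[R]_d.
  by apply; exact: interval_open.
exact: (measurableT_comp mnorm (measurable_translate_rV (- x))).
Qed.

Lemma integral_indic_cube x (s : R) : 0 <= s ->
  (\int[lebesgue_rV d]_y (\1_(cube x s) y)%:E = ((2 * s) ^+ d)%:E)%E.
Proof.
move=> s0; have mc := measurable_cube x s.
by rewrite integral_indic // setIT; exact: lebesgue_cube.
Qed.

(** Here [|y - x|] is the sup norm, so the support lies in a cube of known volume; since the sup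
    norm is below [enorm], the function is still 1 on the Euclidean ball. *)
Definition cutoff x (r : R) y : R := Num.max 0 (Num.min 1 (2 - `|y - x| / r)).

Lemma measurable_cutoff x r : measurable_fun setT (cutoff x r).
Proof.
apply: measurable_maxr => //; apply: measurable_minr => //.
apply: measurable_funB => //; apply: measurable_funM => //.
exact: measurable_normB.
Qed.

Lemma cutoff_ge0 x r y : 0 <= cutoff x r y.
Proof. by rewrite le_max lexx. Qed.

Lemma cutoff_le1 x r y : cutoff x r y <= 1.
Proof. by rewrite ge_max ler01 ge_min lexx. Qed.

Lemma cutoff_ge1 x r y : 0 < r -> `|y - x| < r -> 1 <= cutoff x r y.
Proof.
move=> r0 yx; rewrite le_max; apply/orP; right; rewrite le_min lexx /=.
have : `|y - x| / r <= 1 by rewrite ler_pdivrMr // mul1r ltW.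
by lra.
Qed.

Lemma cutoff_support x r y : 0 < r -> cutoff x r y != 0 -> cube x (2 * r) y.
Proof.
move=> r0 yn0 i.
have := ler_coord_norm (y - x) i; rewrite !mxE => /le_lt_trans; apply.
rewrite ltNge; apply: contra yn0 => h.
have : 2 <= `|y - x| / r by rewrite ler_pdivlMr.
move=> h2; apply/eqP/max_idPl; rewrite ge_min; apply/orP; right; lra.
Qed.

Lemma cutoff_lipschitz x r y z : 0 < r ->
  `|cutoff x r y - cutoff x r z| <= `|y - z| / r.
Proof.
move=> r0.
apply: le_trans (maxr_lipschitz _ _ _) _; apply: le_trans (minr_lipschitz _ _ _) _.
rewrite opprB addrC subrKA distrC.
have ir : 0 < r^-1 by rewrite invr_gt0.
rewrite -mulrBl normrM (gtr0_norm ir) ler_pM2r //.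
apply: le_trans (ler_dist_dist _ _) _.
by rewrite opprB addrA subrK.
Qed.

Lemma cutoff_increment x r y h : 0 < r ->
  `|cutoff x r (y + h) - cutoff x r y| `^ p <=
  hweight p r h * (\1_(cube x (2 * r)) y + \1_(cube (x - h) (2 * r)) y).
Proof.
move=> r0; have p0 : 0 < p by exact: lt_le_trans p_ge1.
have w0 := hweight_ge0 p r h.
have i0 A z : 0 <= \1_A z :> R by rewrite indicE.
have le_w : `|cutoff x r (y + h) - cutoff x r y| `^ p <= hweight p r h.
  rewrite le_min; apply/andP; split.
    apply: powR_le1; first exact: ltW.
    have := cutoff_ge0 x r (y + h); have := cutoff_le1 x r (y + h).
    have := cutoff_ge0 x r y; have := cutoff_le1 x r y.
    by move=> *; rewrite normr_ge0 /= ler_norml; apply/andP; split; lra.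
  rewrite -powR_divE ?enorm_ge0 ?(ltW r0) //.
  apply: ge0_ler_powR; rewrite ?nnegrE ?(ltW p0) ?divr_ge0 ?enorm_ge0 ?(ltW r0) //.
  apply: le_trans (cutoff_lipschitz x _ _ r0) _.
  by rewrite addrAC subrr add0r ler_pM2r ?invr_gt0 // normr_rV_enorm.
(* A nonzero increment needs [y] or [y + h] in the support, and the latter puts [y] in the cube
   around [x - h]. *)
have [y0|yn0] := eqVneq (cutoff x r y) 0; last first.
  apply: le_trans le_w _; rewrite ler_peMr // [X in X + _]indicE mem_set.
    by rewrite lerDl.
  exact: cutoff_support.
have [yh0|yhn0] := eqVneq (cutoff x r (y + h)) 0.
  by rewrite y0 yh0 subrr normr0 powR0 ?gt_eqF // mulr_ge0 // addr_ge0.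
apply: le_trans le_w _; rewrite ler_peMr // [X in _ + X]indicE mem_set.
  by rewrite lerDr.
have := cutoff_support r0 yhn0.
by move=> + i => /(_ i); rewrite !mxE opprB addrA addrAC [X in `|X|]addrAC.
Qed.

Lemma cutoff_lp_mass x r : 0 < r ->
  (lp_mass p (cutoff x r) <= ((4 * r) ^+ d)%:E)%E.
Proof.
move=> r0; have p0 : 0 < p by exact: lt_le_trans p_ge1.
have -> : 4 * r = 2 * (2 * r) by ring.
rewrite -(integral_indic_cube x) ?mulr_ge0 ?(ltW r0) //.
apply: ge0_le_integral => //.
- apply/measurable_EFinP; apply: (measurableT_comp (@measurable_powR R p)).
  apply: (measurableT_comp (@normr_measurable R setT)); exact: measurable_cutoff.
- apply/measurable_EFinP; apply: measurable_indic; exact: measurable_cube.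
move=> y _; rewrite lee_fin.
have [->|yn0] := eqVneq (cutoff x r y) 0.
  by rewrite normr0 powR0 ?gt_eqF // indicE.
rewrite indicE mem_set; last exact: cutoff_support.
apply: powR_le1; first exact: ltW.
by rewrite normr_ge0 ger0_norm ?cutoff_ge0 // cutoff_le1.
Qed.

Lemma cutoff_gagliardo x r : 0 < r ->
  (gagliardo p nu (cutoff x r) <= (2 * (4 * r) ^+ d)%:E * hfun nu p r)%E.
Proof.
move=> r0.
have mc z : measurable_fun setT (fun y => (\1_(cube z (2 * r)) y)%:E : \bar R).
  by apply/measurable_EFinP; apply: measurable_indic; exact: measurable_cube.
apply: (@le_trans _ _ (\int[nu]_h ((2 * (4 * r) ^+ d)%:E * (hweight p r h)%:E))%E).
  apply: ge0_le_integral => //.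
  - by move=> h _; apply: integral_ge0 => y _; rewrite lee_fin powR_ge0.
  - exact: measurable_increment_integral (measurable_cutoff x r).
  - by apply: emeasurable_funM => //; exact: measurable_hweightE.
  move=> h _; rewrite muleC.
  apply: (@le_trans _ _ (\int[lebesgue_rV d]_y ((hweight p r h)%:E *
      ((\1_(cube x (2 * r)) y)%:E + (\1_(cube (x - h) (2 * r)) y)%:E)))%E).
    apply: ge0_le_integral => //.
    - exact: (measurableT_comp (measurable_increment p (measurable_cutoff x r))
        (measurable_pair1 h)).
    - apply: emeasurable_funM => //; exact: emeasurable_funD.
    by move=> y _; rewrite -EFinD -EFinM lee_fin cutoff_increment.
  have w0 := hweight_ge0 p r h.
  rewrite ge0_integralZl_EFin //; last 2 first.
  - by move=> y _; rewrite adde_ge0 // lee_fin.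
  - exact: emeasurable_funD.
  rewrite lee_wpmul2l // ge0_integralD //.
  rewrite !integral_indic_cube ?mulr_ge0 ?(ltW r0) //.
  rewrite -EFinD lee_fin; have -> : 2 * (2 * r) = 4 * r by ring.
  by lra.
rewrite ge0_integralZl_EFin //.
- by move=> h _; rewrite lee_fin hweight_ge0.
- exact: measurable_hweightE.
- by rewrite mulr_ge0 // exprn_ge0 // mulr_ge0 // ltW.
Qed.

Lemma capacity_eball_le x r : 0 < r -> (hfun nu p r < +oo)%E ->
  (capacity nu p (eball x r) <=
    (2 `^ p * 2 * 4 ^+ d * r ^+ d)%:E * (1 + hfun nu p r))%E.
Proof.
move=> r0 hoo; have p0 : 0 < p by exact: lt_le_trans p_ge1.
have h0 : (0 <= hfun nu p r)%E.
  by apply: integral_ge0 => h _; rewrite lee_fin hweight_ge0.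
have r4 : 0 <= (4 * r) ^+ d by rewrite exprn_ge0 // mulr_ge0 // ltW.
have M := cutoff_lp_mass x r0; have D := cutoff_gagliardo x r0.
apply: (@le_trans _ _ (sobolev_norm nu p (cutoff x r) `^ p)%E).
  apply: ereal_inf_lbound; exists (cutoff x r) => //; split.
    split; first exact: measurable_cutoff.
    rewrite /sobolev_norm Lnorm_lp_mass; apply: lte_add_pinfty.
      by apply: poweR_lty; apply: le_lt_trans M (ltry _).
    apply: poweR_lty; apply: le_lt_trans D _.
    by rewrite lte_mul_pinfty // lee_fin mulr_ge0.
  (* The open sup-norm ball around [x] is a neighbourhood of [y] on which the cutoff is at least 1;
     this gives the interior in the definition of capacity. *)
  move=> y yr; have yxr : `|y - x| < r := le_lt_trans (normr_rV_enorm _) yr.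
  have : nbhs y (ball x r).
    apply: open_nbhs_nbhs; split; first exact: ball_open.
    by rewrite -ball_normE /= distrC.
  apply: filterS => z; rewrite -ball_normE /= distrC => zr.
  exact: cutoff_ge1.
apply: le_trans (sobolev_norm_le p_ge1 nu _) _.
have -> : 2 `^ p * 2 * 4 ^+ d * r ^+ d = 2 `^ p * (2 * (4 * r) ^+ d) :> R.
  by rewrite exprMn; ring.
rewrite EFinM -muleA lee_wpmul2l ?lee_fin ?powR_ge0 //.
rewrite ge0_muleDr // mule1; apply: leeD; last exact: D.
apply: le_trans M _; rewrite lee_fin ler_peMl // ler1n //.
Qed.

End upper_bound.

(** * The lower bound *)

Section lower_bound_tools.
Context {R : realType} {d : nat}.
Variables (p : R) (p_ge1 : 1 <= p) (nu : {measure set 'rV[R]_d -> \bar R}).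
Variables (k : 'rV[R]_d -> R) (k_density : has_density nu k).
Implicit Types x y z h : 'rV[R]_d.
Local Open Scope ereal_scope.

Lemma gagliardo_density (f : 'rV[R]_d -> R) : measurable_fun setT f ->
  gagliardo p nu f = \int[lebesgue_rV d]_h \int[lebesgue_rV d]_x
    ((`|f (x + h) - f x| `^ p)%:E * (k h)%:E).
Proof.
move=> mf; have [mk k0 _] := k_density.
rewrite /gagliardo (density_integral k_density); last 2 first.
- exact: measurable_increment_integral.
- by move=> h; apply: integral_ge0 => x _; rewrite lee_fin powR_ge0.
apply: eq_integral => h _; rewrite ge0_integralZr //.
- exact: (measurableT_comp (measurable_increment p mf) (pair1_measurable h)).
- by rewrite lee_fin.
Qed.

Lemma integral_indic_translate x (B : set 'rV[R]_d) : measurable B ->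
  \int[lebesgue_rV d]_h (\1_B (x + h))%:E = lebesgue_rV d B.
Proof.
move=> mB.
have mB' : measurable ((fun v => v + x)%R @^-1` B).
  by rewrite -[X in measurable X]setTI; exact: measurable_translate_rV.
rewrite (eq_integral (fun h => (\1_((fun v => v + x)%R @^-1` B) h)%:E)).
  by rewrite integral_indic // setIT; exact: lebesgue_rV_translate.
by move=> h _; rewrite !indicE addrC; congr (_%:R%:E); apply/idP/idP; rewrite !inE.
Qed.

(** Only pairs with [x] in [G] and [x + h] in some [B i] are kept; disjointness leaves at most one
    term at each pair. After Tonelli, translation invariance turns the inner integral over [h] into
    the volumes of the [B i]. *)
Lemma gagliardo_ge (f : 'rV[R]_d -> R) n (c b : 'I_n -> R) (g : R)
    (G : set 'rV[R]_d) (B : 'I_n -> set 'rV[R]_d) :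
  measurable_fun setT f -> measurable G -> (forall i, measurable (B i)) ->
  (0 <= g)%R -> (forall i, 0 <= c i)%R -> (forall i, 0 <= b i)%R ->
  (forall i j z, B i z -> B j z -> i = j) ->
  (forall i y z, G y -> B i z -> c i <= `|f z - f y| `^ p * k (z - y))%R ->
  g%:E <= lebesgue_rV d G -> (forall i, (b i)%:E <= lebesgue_rV d (B i)) ->
  ((\sum_(i < n) c i * b i) * g)%:E <= gagliardo p nu f.
Proof.
move=> mf mG mB g0 c0 b0 Binj cf gG bB.
have [mk k0 _] := k_density.
pose F hx : \bar R := ((\1_G hx.2 : R)%:E * \sum_(i < n) (c i * \1_(B i) (hx.2 + hx.1))%:E).
have i0 (A : set 'rV[R]_d) z : (0 <= \1_A z :> R)%R by rewrite indicE.
have s0 z : 0 <= \sum_(i < n) (c i * \1_(B i) z)%:E.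
  by apply: sume_ge0 => i _; rewrite lee_fin mulr_ge0.
have F0 hx : 0 <= F hx by rewrite mule_ge0 // lee_fin.
have mFi i : measurable_fun setT (fun hx : 'rV[R]_d * 'rV[R]_d =>
    (c i * \1_(B i) (hx.2 + hx.1))%:E).
  apply/measurable_EFinP; apply: measurable_funM => //.
  exact: (measurableT_comp (measurable_indic (mB i)) measurable_add_rV).
have mF : measurable_fun setT F.
  apply: emeasurable_funM.
    apply/measurable_EFinP.
    exact: (measurableT_comp (measurable_indic mG) measurable_snd).
  by apply: emeasurable_sum => i _; exact: mFi.
have mF1 h : measurable_fun setT (fun x => F (h, x)).
  exact: (measurableT_comp mF (pair1_measurable h)).
rewrite gagliardo_density //.
apply: (@le_trans _ _ (\int[lebesgue_rV d]_h \int[lebesgue_rV d]_x F (h, x))); last first.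
  have mI : measurable_fun setT (fun hx : 'rV[R]_d * 'rV[R]_d =>
      (`|f (hx.2 + hx.1) - f hx.2| `^ p)%:E * (k hx.1)%:E).
    apply: emeasurable_funM; first exact: measurable_increment.
    by apply/measurable_EFinP; exact: (measurableT_comp mk measurable_fst).
  have I0 (hx : 'rV[R]_d * 'rV[R]_d) :
      0 <= (`|f (hx.2 + hx.1) - f hx.2| `^ p)%:E * (k hx.1)%:E.
    by rewrite mule_ge0 // lee_fin ?powR_ge0.
  apply: ge0_le_integral => //.
  - by move=> h _; apply: integral_ge0 => x _; exact: F0.
  - exact: measurable_fun_fubini_tonelli_F.
  - exact: (measurable_fun_fubini_tonelli_F (m2 := lebesgue_rV d) _ mI I0).
  move=> h _; apply: ge0_le_integral => //.
  - exact: (measurableT_comp mI (pair1_measurable h)).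
  move=> x _; rewrite /F /=.
  have [xG|xG] := pselect (G x); last first.
    by rewrite indicE memNset // mul0e; exact: (I0 (h, x)).
  rewrite indicE mem_set // mul1e -EFinM.
  have [[i xB]|nB] := pselect (exists i, B i (x + h)%R); last first.
    rewrite big1 ?lee_fin ?mulr_ge0 ?powR_ge0 // => i _.
    by rewrite indicE memNset ?mulr0 // => xB; apply: nB; exists i.
  rewrite (bigD1 i) //= indicE mem_set // mulr1 big1 ?adde0; last first.
    move=> j ji; rewrite indicE memNset ?mulr0 // => xBj.
    by move: ji; rewrite (Binj _ _ _ xB xBj) eqxx.
  by rewrite lee_fin; have := cf i x (x + h)%R xG xB; rewrite addrAC subrr add0r.
rewrite (fubini_tonelli (m1 := lebesgue_rV d) (m2 := lebesgue_rV d) F) //.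
have inner x : \int[lebesgue_rV d]_h F (h, x) =
    (\sum_(i < n) (c i)%:E * lebesgue_rV d (B i)) * (\1_G x)%:E.
  rewrite /F /= ge0_integralZl_EFin //; last first.
    apply: emeasurable_sum => i _.
    exact: (measurableT_comp (mFi i) (pair2_measurable x)).
  rewrite muleC; congr (_ * _).
  rewrite ge0_integral_sum //; last 2 first.
  - move=> i; exact: (measurableT_comp (mFi i) (pair2_measurable x)).
  - by move=> i h _; rewrite lee_fin mulr_ge0.
  apply: eq_bigr => i _; under eq_integral do rewrite EFinM.
  rewrite ge0_integralZl_EFin ?integral_indic_translate //.
  apply/measurable_EFinP.
  have mt : measurable_fun setT (fun h => x + h)%R.
    by under eq_fun do rewrite addrC; exact: measurable_translate_rV.
  exact: (measurableT_comp (measurable_indic (mB i)) mt).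
under eq_integral do rewrite inner.
have cB0 : 0 <= \sum_(i < n) (c i)%:E * lebesgue_rV d (B i).
  by apply: sume_ge0 => i _; rewrite mule_ge0 // lee_fin.
have mGi : measurable_fun setT (fun x => (\1_G x : R)%:E).
  by apply/measurable_EFinP; exact: measurable_indic.
rewrite ge0_integralZl //.
rewrite integral_indic // setIT EFinM; apply: lee_pmul => //.
- by rewrite lee_fin sumr_ge0 // => i _; rewrite mulr_ge0.
rewrite -sumEFin; apply: lee_sum => i _.
by rewrite EFinM lee_wpmul2l // lee_fin.
Qed.

(** Chebyshev's inequality at level [t]. *)
Lemma lp_mass_ge (f : 'rV[R]_d -> R) (A : set 'rV[R]_d) (t a : R) :
  measurable_fun setT f -> measurable A -> (0 <= t)%R ->
  (forall x, A x -> t <= f x)%R -> a%:E <= lebesgue_rV d A ->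
  (t `^ p * a)%:E <= lp_mass p f.
Proof.
move=> mf mA t0 tf aA; have p0 : (0 < p)%R by exact: lt_le_trans p_ge1.
apply: (@le_trans _ _ (\int[lebesgue_rV d]_x ((t `^ p)%:E * (\1_A x)%:E))).
  rewrite ge0_integralZl_EFin ?powR_ge0 //; last first.
    by apply/measurable_EFinP; exact: measurable_indic.
  by rewrite integral_indic // setIT EFinM lee_wpmul2l // lee_fin powR_ge0.
have pf0 x : 0 <= (`|f x| `^ p)%:E by rewrite lee_fin powR_ge0.
apply: ge0_le_integral => //.
- by move=> x _; rewrite mule_ge0 // lee_fin powR_ge0.
- by apply: emeasurable_funM => //; apply/measurable_EFinP; exact: measurable_indic.
- apply/measurable_EFinP; apply: (measurableT_comp (@measurable_powR R p)).
  exact: (measurableT_comp (@normr_measurable R setT)).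
move=> x _; rewrite indicE; case: (boolP (x \in A)) => [|_]; last by rewrite mule0.
rewrite inE mule1 lee_fin => /tf tx.
apply: ge0_ler_powR; rewrite ?nnegrE ?(ltW p0) //.
exact: le_trans tx (ler_norm _).
Qed.

Lemma measure_half (Q A : set 'rV[R]_d) (v : R) : measurable Q -> measurable A ->
  lebesgue_rV d Q = (2 * v)%:E ->
  ~ v%:E <= lebesgue_rV d (Q `&` A) -> v%:E <= lebesgue_rV d (Q `&` ~` A).
Proof.
move=> mQ mA Qv /negP; rewrite -ltNge => QA; rewrite leNgt; apply/negP => QB.
have e : lebesgue_rV d Q = lebesgue_rV d (Q `&` A) + lebesgue_rV d (Q `&` ~` A).
  by rewrite addeC -setDE; exact: measureDI.
have := lteD QA QB; rewrite -e Qv -EFinD lte_fin; lra.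
Qed.

End lower_bound_tools.

(** The volumes absorb the factors [2 ^ d], since [(2 ^ i * r) ^ d * 2 ^ (d * (J - i)) = (2 ^ J * r)
    ^ d]. What is left is the sum of [q ^ (J - i)], of order [q ^ J], and writing [r ^ d] as
    [(2 ^ J * r) ^ d / 2 ^ (d * J)] turns [q ^ J] into [(q / 2 ^ d) ^ J]. *)
Lemma geometric_dyadic_sum (R : realType) (d : nat) (q K r : R) (J : nat) (F : nat -> R) :
  0 < r -> 1 < q -> 0 <= K -> 0 <= F J ->
  (forall i, (i <= J)%N -> F i <= K * (2 ^+ d * q) ^+ (J - i) * F J) ->
  r ^+ d * (\sum_(i < J.+1) (2 ^+ i * r) ^+ d * F i) <=
  K * q / (q - 1) * ((q / 2 ^+ d) ^+ J * ((2 ^+ J * r) ^+ d) ^+ 2 * F J).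
Proof.
move=> r0 q1 K0 FJ0 FiJ; have q0 : 0 < q by exact: lt_trans q1.
have sumq : \sum_(i < J.+1) q ^+ (J - i) <= q ^+ J * q / (q - 1).
  rewrite (reindex_inj rev_ord_inj) /=.
  rewrite (eq_bigr (fun i : 'I_J.+1 => q ^+ i)); last first.
    by move=> i _; rewrite subSS subKn // -ltnS.
  rewrite ler_pdivlMr ?subr_gt0 // mulrC -subrX1 exprSr.
  by rewrite gerBl.
have r0d : 0 <= r ^+ d by rewrite exprn_ge0 // ltW.
have sJ0 : 0 <= (2 ^+ J * r) ^+ d by rewrite exprn_ge0 // mulr_ge0 ?exprn_ge0 // ltW.
have sJE i : (i <= J)%N ->
    (2 ^+ J * r) ^+ d = (2 ^+ i * r) ^+ d * (2 ^+ d) ^+ (J - i).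
  move=> iJ; rewrite -{1}(subnKC iJ) exprD !exprMn -!exprM [((J - i) * d)%N]mulnC.
  by ring.
apply: (@le_trans _ _ (r ^+ d * (K * F J * (2 ^+ J * r) ^+ d * (q ^+ J * q / (q - 1))))).
  rewrite ler_wpM2l //.
  apply: (@le_trans _ _ (K * F J * (2 ^+ J * r) ^+ d * \sum_(i < J.+1) q ^+ (J - i))).
    rewrite mulr_sumr; apply: ler_sum => i _.
    have iJ : (i <= J)%N by rewrite -ltnS.
    apply: (@le_trans _ _ ((2 ^+ i * r) ^+ d * (K * (2 ^+ d * q) ^+ (J - i) * F J))).
      rewrite ler_wpM2l ?FiJ //.
      by rewrite exprn_ge0 // mulr_ge0 ?exprn_ge0 // ltW.
    rewrite le_eqVlt; apply/orP; left; apply/eqP.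
    by rewrite (sJE _ iJ) [(2 ^+ d * q) ^+ _]exprMn; ring.
  by rewrite ler_wpM2l // !mulr_ge0.
rewrite le_eqVlt; apply/orP; left; apply/eqP.
have e2 : ((2 : R) ^+ d) ^+ J != 0 by rewrite !expf_neq0 // pnatr_eq0.
have -> : (q / 2 ^+ d) ^+ J = q ^+ J / (2 ^+ d) ^+ J by rewrite expr_div_n.
have -> : (2 ^+ J * r) ^+ d = (2 ^+ d) ^+ J * r ^+ d.
  by rewrite exprMn -!exprM mulnC.
have q1' : q - 1 != 0 by rewrite subr_eq0 gt_eqF.
by field; rewrite e2 q1'.
Qed.

(** * Geometry of the core cube and its satellites *)

Section lower_bound.
Context {R : realType} {d : nat}.
Variables (d_gt0 : (0 < d)%N) (p : R) (p_ge1 : 1 <= p).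
Variables (nu : {measure set 'rV[R]_d -> \bar R}).
Variables (k : 'rV[R]_d -> R) (k_density : has_density nu k).
Variables (phi : R -> R) (phi_gt0 : forall t : R, 0 < t -> 0 < phi t).
Hypothesis k_radial : has_radial_profile k phi.
Variables (q K R0 : R) (q12 : 1 < q < 2) (K_ge1 : 1 <= K) (R0_gt0 : 0 < R0).
Hypothesis growth : forall (m : nat) s, 0 < s -> 2 ^+ m * s < R0 ->
  phi s <= K * (2 ^+ d * q) ^+ m * phi (2 ^+ m * s).
Hypothesis doubling : forall s t, 0 < s -> s <= t <= 8 * s -> t < R0 ->
  phi s <= K * phi t.
Implicit Types x y z h : 'rV[R]_d.

Let i0 : 'I_d := Ordinal d_gt0.
Let dR_ge1 : 1 <= d%:R :> R. Proof. by rewrite ler1n. Qed.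
Let dR_gt0 : 0 < d%:R :> R. Proof. by rewrite ltr0n. Qed.

(* The profile may be tiny near 0, so energy is only harvested between sets
   whose distance is comparable to their size: [satellite x s] is a cube of
   side [2 s / d] centred at distance [5 s] from [x] along the first axis. *)
Definition side (s : R) : R := s / d%:R.
Definition satellite x (s : R) : set 'rV[R]_d :=
  cube (x + (5 * s) *: delta_mx ord0 i0) (side s).

Lemma side_gt0 s : 0 < s -> 0 < side s.
Proof. by move=> s0; rewrite divr_gt0. Qed.

Lemma side_le s : 0 < s -> side s <= s.
Proof. by move=> s0; rewrite ler_pdivrMr // ler_peMr // ltW. Qed.

Lemma side2 s : side (2 * s) = 2 * side s.
Proof. by rewrite /side mulrA. Qed.

Lemma le_side r s : r <= s -> side r <= side s.
Proof. by move=> rs; rewrite ler_pM2r // invr_gt0. Qed.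

Lemma satelliteP x s z : satellite x s z ->
  forall i, `|z ord0 i - x ord0 i - (5 * s) *+ (i == i0)| < side s.
Proof.
move=> + i => /(_ i); rewrite !mxE eqxx /= opprD addrA.
by rewrite mulr_natr.
Qed.

(** The first coordinate is at least [5 * s - 3 * s]. For the upper bound, the coordinatewise errors
    add up to [d * 3 * side s = 3 * s] on top of [5 * s]. *)
Lemma enorm_between h s : 0 < s ->
  (forall i, `|h ord0 i - (5 * s) *+ (i == i0)| <= 3 * side s) ->
  2 * s <= enorm h <= 8 * s.
Proof.
move=> s0 hh; apply/andP; split.
  apply: le_trans (ler_coord_enorm h i0).
  have := hh i0; rewrite eqxx mulr1n ler_norml => /andP[h1 _].
  have := side_le s0; have := ler_norm (h ord0 i0); lra.
apply: le_trans (enorm_le_sum h) _.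
apply: (@le_trans _ _ (\sum_(i < d) (3 * side s + (5 * s) *+ (i == i0)))).
  apply: ler_sum => i _; have := hh i.
  have := ler_normD (h ord0 i - (5 * s) *+ (i == i0)) ((5 * s) *+ (i == i0)).
  rewrite subrK; have : `|(5 * s) *+ (i == i0)| = (5 * s) *+ (i == i0).
    by rewrite ger0_norm // mulrn_wge0 // mulr_ge0 // ltW.
  by move=> -> *; lra.
have -> : \sum_(i < d) (3 * side s + (5 * s) *+ (i == i0)) = 3 * s + 5 * s.
  rewrite big_split /= sumr_const card_ord -[(3 * side s) *+ d]mulr_natr.
  rewrite /side -mulrA divfK ?gt_eqF //.
  rewrite (bigD1 i0) //= [X in _ + (_ + X)]big1 => [|i /negbTE ->].
    by rewrite ?eqxx ?mulr1n addr0.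
  by rewrite mulr0n.
by lra.
Qed.

Lemma core_satellite_dist x y z r s : 0 < r -> r <= s ->
  cube x (side r) y -> satellite x s z -> 2 * s <= enorm (z - y) <= 8 * s.
Proof.
move=> r0 rs xy /satelliteP xz; have s0 := lt_le_trans r0 rs.
apply: enorm_between => // i; rewrite !mxE.
have := xy i; have := xz i; have := le_side rs; have := side_gt0 s0.
move: ((5 * s) *+ _) => a.
rewrite !ltr_norml ler_norml => ? ? /andP[? ?] /andP[? ?].
by apply/andP; split; lra.
Qed.

(** The centres at distances [5 * s] and [10 * s] differ by [5 * s], and the two half-sides add up
    to [3 * side s], so [enorm_between] applies at scale [s]. *)
Lemma satellites_dist x y z s : 0 < s ->
  satellite x s y -> satellite x (2 * s) z -> 2 * s <= enorm (z - y) <= 8 * s.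
Proof.
move=> s0 /satelliteP xy /satelliteP xz.
apply: enorm_between => // i; rewrite !mxE.
have := xy i; have := xz i; have := side_gt0 s0; rewrite side2.
have -> : (5 * (2 * s)) *+ (i == i0) = 2 * ((5 * s) *+ (i == i0)).
  by rewrite mulrCA mulrnAr.
move: ((5 * s) *+ _) => a.
rewrite !ltr_norml ler_norml => ? /andP[? ?] /andP[? ?].
by apply/andP; split; lra.
Qed.

(** Along the first axis, a satellite of scale [s] stays between [4 * s] and [6 * s] from [x], while
    larger scales begin at [8 * s]. *)
Lemma satellites_disjoint x r (i j : nat) z : 0 < r ->
  satellite x (2 ^+ i * r) z -> satellite x (2 ^+ j * r) z -> i = j.
Proof.
move=> r0; wlog ij : i j / (i <= j)%N => [H zi zj|].
  by case/orP: (leq_total i j) => ij; [exact: H | apply/esym; exact: H].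
move=> /satelliteP/(_ i0) zi /satelliteP/(_ i0) zj.
move: ij; rewrite leq_eqVlt => /predU1P[//|ij].
move: zi zj; rewrite eqxx !mulr1n !ltr_norml => /andP[_ zi] /andP[zj _].
have si : 0 < 2 ^+ i * r by rewrite mulr_gt0 // exprn_gt0.
have sj : 0 < 2 ^+ j * r by rewrite mulr_gt0 // exprn_gt0.
have sij : 2 * (2 ^+ i * r) <= 2 ^+ j * r.
  by rewrite mulrA -exprS ler_pM2r // ler_weXn2l // ler1n.
exfalso; have := side_le si; have := side_le sj; lra.
Qed.

Lemma density_ge h s : 0 < s -> 8 * s < R0 -> 2 * s <= enorm h <= 8 * s ->
  K^-1 * phi (2 * s) <= k h.
Proof.
move=> s0 sR /andP[h1 h2]; have K0 : 0 < K by exact: lt_le_trans K_ge1.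
have hpos : 0 < enorm h by apply: lt_le_trans h1; rewrite mulr_gt0.
rewrite k_radial ?enorm_neq0 // ler_pdivrMl //; apply: doubling.
- by rewrite mulr_gt0.
- by rewrite h1 /=; lra.
- exact: le_lt_trans h2 sR.
Qed.

(* [w s^d] is half the volume of a cube of half-side [side s]. *)
Let w : R := (2 / d%:R) ^+ d / 2.
Let w_gt0 : 0 < w. Proof. by rewrite !divr_gt0 // exprn_gt0 // divr_gt0. Qed.

Lemma lebesgue_cube_side c s : 0 < s ->
  lebesgue_rV d (cube c (side s)) = (2 * (w * s ^+ d))%:E.
Proof.
move=> s0; rewrite [LHS]lebesgue_cube ?(ltW (side_gt0 s0)) //; congr (_%:E).
rewrite /side /w (_ : 2 * (s / d%:R) = (2 / d%:R) * s); last by ring.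
by rewrite exprMn; field.
Qed.

(** [th] is the [p]-th root of [u], so that drops of size [th ^ J] carry energy [u ^ J], the very
    factor produced by [geometric_dyadic_sum]. *)
Let u : R := q / 2 ^+ d.
Let th : R := u `^ p^-1.
Let p_gt0 : 0 < p. Proof. exact: lt_le_trans p_ge1. Qed.
Let q_gt0 : 0 < q. Proof. by case/andP: q12 => + _; exact: lt_trans. Qed.
Let K_gt0 : 0 < K. Proof. exact: lt_le_trans K_ge1. Qed.
Let u_gt0 : 0 < u. Proof. by rewrite divr_gt0 // exprn_gt0. Qed.
Let u_lt1 : u < 1.
Proof.
rewrite ltr_pdivrMr ?exprn_gt0 // mul1r; case/andP: q12 => _ /lt_le_trans; apply.
by rewrite -[leLHS]expr1 ler_weXn2l // ler1n.
Qed.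
Let th_gt0 : 0 < th. Proof. exact: powR_gt0. Qed.
Let th_lt1 : th < 1.
Proof.
suff : u `^ p^-1 < 1 `^ p^-1 by rewrite powR1.
by apply: gt0_ltr_powR; rewrite ?invr_gt0 // nnegrE // ltW.
Qed.
Let thXp n : (th ^+ n) `^ p = u ^+ n.
Proof.
have thp : th `^ p = u by rewrite /th -powRrM mulVf ?gt_eqF // powRr1 // ltW.
rewrite -(powR_mulrn n (ltW th_gt0)) -powRrM [n%:R * p]mulrC powRrM thp.
by rewrite powR_mulrn // ltW.
Qed.

(** [CA] serves the scales above the last good one. In [CB] the first factor is that of the
    geometric sum; the two summands cover a last good scale below [N] and equal to [N], where
    [R0 / 8] bounds the top scale and [K * phi (R0 / 2)] the profile at twice that scale. *)
Let CA : R := K / (2^-1 `^ p * w ^+ 2).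
Let CB : R := K * q / (q - 1) *
  (K / (((1 - th) / 2) `^ p * w ^+ 2) +
   (R0 / 8) ^+ d * (K * phi (R0 / 2)) / (2^-1 `^ p * w)).
Let C : R := CA + CB.

Let e_gt0 : 0 < 2^-1 `^ p :> R. Proof. by rewrite powR_gt0. Qed.
Let a_gt0 : 0 < ((1 - th) / 2) `^ p :> R.
Proof. by rewrite powR_gt0 // divr_gt0 // subr_gt0. Qed.
Let q1_gt0 : 0 < K * q / (q - 1).
Proof. by rewrite divr_gt0 ?mulr_gt0 // subr_gt0; case/andP: q12. Qed.

Let CA0 : 0 < CA.
Proof. by rewrite divr_gt0 // mulr_gt0 // exprn_gt0. Qed.
Let CB0 : 0 < CB.
Proof.
have h1 : 0 < ((1 - th) / 2) `^ p * w ^+ 2 by rewrite mulr_gt0 // exprn_gt0.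
have h2 : 0 < (R0 / 8) ^+ d by rewrite exprn_gt0 // divr_gt0.
have h3 : 0 < phi (R0 / 2) by rewrite phi_gt0 // divr_gt0.
apply: mulr_gt0 => //; apply: addr_gt0; first exact: divr_gt0.
by apply: divr_gt0; apply: mulr_gt0 => //; exact: mulr_gt0.
Qed.
Let C0 : 0 < C. Proof. exact: addr_gt0. Qed.

(** * The energy inequality for one competitor *)

Section fixed_function.
Variables (f : 'rV[R]_d -> R) (mf : measurable_fun setT f).
Variables (x : 'rV[R]_d) (r : R) (r_gt0 : 0 < r) (N : nat).
Hypothesis fx : forall y, cube x (side r) y -> 1 <= f y.
Hypothesis NR : 8 * (2 ^+ N * r) < R0.

Let s (i : nat) : R := 2 ^+ i * r.
Let t (i : nat) : R := th ^+ i / 2.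
Let S (i : nat) : set 'rV[R]_d := [set y | t i <= f y].
Let P (i : nat) : Prop :=
  ((w * s i ^+ d)%:E <= lebesgue_rV d (satellite x (s i) `&` S i))%E.

Let s_gt0 i : 0 < s i. Proof. by rewrite mulr_gt0 // exprn_gt0. Qed.
Let s_geR i : r <= s i.
Proof. by rewrite ler_peMl ?(ltW r_gt0) // exprn_ege1 // ler1n. Qed.
Let s_le i j : (i <= j)%N -> s i <= s j.
Proof. by move=> ij; rewrite ler_pM2r // ler_weXn2l // ler1n. Qed.
Let sS i : s i.+1 = 2 * s i. Proof. by rewrite /s exprS mulrA. Qed.
Let s8 i : (i <= N)%N -> 8 * s i < R0.
Proof. by move=> /s_le iN; apply: le_lt_trans NR; rewrite ler_pM2l. Qed.
Let F_gt0 i : 0 < phi (s i.+1). Proof. exact: phi_gt0. Qed.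
Let v_gt0 i : 0 < w * s i ^+ d. Proof. by rewrite mulr_gt0 // exprn_gt0. Qed.

Let mS i : measurable (S i).
Proof.
rewrite (_ : S i = f @^-1` `[t i, +oo[%classic).
  by rewrite -[X in measurable X]setTI; apply: mf.
by apply/seteqP; split=> y /=; rewrite in_itv /= andbT.
Qed.

Let mSat i : measurable (satellite x (s i)). Proof. exact: measurable_cube. Qed.

Let bad i : set 'rV[R]_d := satellite x (s i) `&` ~` S i.
Let mbad i : measurable (bad i).
Proof. by apply: measurableI => //; exact: measurableC. Qed.

Let bad_ge i : ~ P i -> ((w * s i ^+ d)%:E <= lebesgue_rV d (bad i))%E.
Proof.
move=> nP; apply: (measure_half (mSat i) (mS i) _ nP).
exact: lebesgue_cube_side.
Qed.

Let t_le i : t i <= 2^-1.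
Proof.
by rewrite ler_pdivrMr // mulVf ?pnatr_eq0 // exprn_ile1 // ltW.
Qed.

(* The branch value [0] discards the scales at which [f] is mostly large. *)
Let core_bound : (((\sum_(i < N.+1) (2^-1 `^ p * (K^-1 * phi (s i.+1))) *
    (if `[< P i >] then 0 else w * s i ^+ d)) * (w * r ^+ d))%:E <=
  gagliardo p nu f)%E.
Proof.
apply: (gagliardo_ge k_density (G := cube x (side r))
  (B := fun i : 'I_N.+1 => bad i)) => //.
- exact: measurable_cube.
- by rewrite mulr_ge0 ?exprn_ge0 ?(ltW w_gt0) ?(ltW r_gt0).
- by move=> i; rewrite !mulr_ge0 ?powR_ge0 ?invr_ge0 ?(ltW K_gt0) ?(ltW (F_gt0 i)).
- by move=> i; case: ifP => // _; exact: ltW.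
- by move=> i j z [zi _] [zj _]; apply: val_inj; exact: satellites_disjoint zi zj.
- move=> i y z xy [xz /negP]; rewrite -ltNge => zt.
  apply: ler_pM; rewrite ?powR_ge0 ?mulr_ge0 ?invr_ge0 ?(ltW K_gt0) ?(ltW (F_gt0 i)) //.
    apply: ge0_ler_powR; rewrite ?nnegrE ?(ltW p_gt0) ?invr_ge0 //.
    (* [f] is at least 1 on the core and below [t i <= 1/2] on the bad set, so the increment is at
       least 1/2. *)
    have := fx xy; have := t_le i; have := ler_norm (f y - f z).
    by rewrite distrC; lra.
  rewrite sS; apply: density_ge => //; first by apply: s8; rewrite -ltnS.
  exact: core_satellite_dist (s_geR i) xy xz.
- rewrite [leRHS]lebesgue_cube_side // lee_fin ler_peMl // ?ler1n //.
  by rewrite mulr_ge0 ?exprn_ge0 ?(ltW w_gt0) ?(ltW r_gt0).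
- move=> i; case: ifPn => [_|/asboolPn]; first exact: measure_ge0.
  exact: bad_ge.
Qed.

(* [t J - t J.+1 = (1 - th) / 2 * th ^+ J], whose [p]-th power carries [u ^+ J]. *)
Let crossing_bound J : (J < N)%N -> P J -> ~ P J.+1 ->
  ((((1 - th) / 2) `^ p * u ^+ J * (K^-1 * phi (s J.+1)) *
    (w * s J.+1 ^+ d) * (w * s J ^+ d))%:E <= gagliardo p nu f)%E.
Proof.
move=> JN PJ nPJ.
have := @gagliardo_ge R d p nu k k_density f 1
  (fun=> ((1 - th) / 2) `^ p * u ^+ J * (K^-1 * phi (s J.+1)))
  (fun=> w * s J.+1 ^+ d) (w * s J ^+ d) (satellite x (s J) `&` S J)
  (fun=> bad J.+1); rewrite big_ord1; apply => //.
- by apply: measurableI.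
- exact: ltW.
- move=> _; rewrite !mulr_ge0 ?powR_ge0 ?exprn_ge0 ?invr_ge0 //;
    by rewrite ?(ltW K_gt0) ?(ltW u_gt0) ?(ltW (F_gt0 J)).
- by move=> _; exact: ltW.
- by move=> i j z _ _; rewrite !ord1.
- move=> _ y z [xy yt] [xz /negP]; rewrite -ltNge => zt.
  apply: ler_pM; rewrite ?mulr_ge0 ?powR_ge0 ?exprn_ge0 ?invr_ge0
    ?(ltW K_gt0) ?(ltW u_gt0) ?(ltW (F_gt0 J)) //.
    rewrite -thXp -powRM ?exprn_ge0 ?(ltW th_gt0) ?divr_ge0 ?subr_ge0 ?(ltW th_lt1) //.
    apply: ge0_ler_powR; rewrite ?nnegrE ?(ltW p_gt0) ?mulr_ge0 ?exprn_ge0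
      ?(ltW th_gt0) ?subr_ge0 ?(ltW th_lt1) //.
    apply: (@le_trans _ _ (f y - f z)); last by rewrite distrC ler_norm.
    move: yt zt; rewrite /S /= /t exprS => yt zt; nra.
  rewrite sS; apply: density_ge => //; first by apply: s8; exact: ltnW.
  by apply: satellites_dist xy _; rewrite // -sS.
- by move=> _; exact: bad_ge.
Qed.

Let top_bound : P N -> ((t N `^ p * (w * s N ^+ d))%:E <= lp_mass p f)%E.
Proof.
move=> PN; apply: (lp_mass_ge p_ge1 mf (A := satellite x (s N) `&` S N)) => //.
- exact: measurableI.
- by rewrite divr_ge0 // exprn_ge0 // ltW.
- by move=> y [].
Qed.

Hypothesis RN : R0 <= 32 * (2 ^+ N * r).

(** The geometric sum reduces everything to scale [J]. For [J < N] the crossing energy pays. For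
    [J = N] the [L^p] mass pays, because [NR] and [RN] keep the top scale comparable to [R0], so
    that [s N ^ d * phi (s N.+1)] is below the constant [Z]. *)
Let low_bound J (m D : R) : (J <= N)%N -> P J -> (J < N -> ~ P J.+1)%N ->
  lp_mass p f = m%:E -> gagliardo p nu f = D%:E -> 0 <= m -> 0 <= D ->
  r ^+ d * (\sum_(i < J.+1) s i ^+ d * phi (s i.+1)) <= CB * (m + D).
Proof.
move=> JN PJ nPJ mE DE m0 D0.
have q1 : 1 < q by case/andP: q12.
have sJ : s J.+1 < R0 by rewrite sS; have := s8 JN; have := s_gt0 J; move=> *; lra.
have FJ i : (i <= J)%N -> phi (s i.+1) <= K * (2 ^+ d * q) ^+ (J - i) * phi (s J.+1).
  move=> iJ; have e : 2 ^+ (J - i) * s i.+1 = s J.+1.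
    by rewrite /s mulrA -exprD addnS subnK.
  by rewrite -e; apply: growth; rewrite // e.
apply: le_trans (geometric_dyadic_sum r_gt0 q1 (ltW K_gt0) (ltW (F_gt0 J)) FJ) _.
rewrite /CB -[leRHS]mulrA ler_pM2l // -/(s J) -/u.
set Z := (R0 / 8) ^+ d * _.
have Z0 : 0 < Z by rewrite !mulr_gt0 ?exprn_gt0 ?phi_gt0 ?divr_gt0.
set a := ((1 - th) / 2) `^ p; set e := 2^-1 `^ p.
set F := phi (s J.+1); set v := s J ^+ d; set U := u ^+ J.
have F0 : 0 < F by exact: F_gt0.
have v0 : 0 < v by rewrite exprn_gt0.
have U0 : 0 < U by rewrite exprn_gt0.
have K1 : 0 < K / (a * w ^+ 2) by rewrite divr_gt0 // mulr_gt0 // exprn_gt0.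
have K2 : 0 < Z / (e * w) by rewrite divr_gt0 // mulr_gt0.
have [JltN|NleJ] := ltnP J N.
  have cb := crossing_bound JltN PJ (nPJ JltN); rewrite DE lee_fin -/a -/U -/F -/v in cb.
  apply: (@le_trans _ _ (K / (a * w ^+ 2) * D)); last first.
    by apply: ler_pM; rewrite ?lerDl ?lerDr ?(ltW K1) ?(ltW K2).
  have aw : 0 < a * w ^+ 2 by rewrite mulr_gt0 // exprn_gt0.
  rewrite [leRHS]mulrAC ler_pdivlMr //.
  rewrite [leRHS]mulrC -ler_pdivrMr //; apply: le_trans cb.
  have vv : v <= s J.+1 ^+ d.
    by apply: lerXn2r; rewrite ?nnegrE ?(ltW (s_gt0 _)) // s_le.
  apply: (@le_trans _ _ (a * U * (K^-1 * F) * (w * v) * (w * v))).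
    by rewrite le_eqVlt; apply/orP; left; apply/eqP; field; rewrite gt_eqF.
  have aUKF : 0 < a * U * (K^-1 * F).
    by apply: mulr_gt0; apply: mulr_gt0 => //; rewrite invr_gt0.
  apply: ler_wpM2r; first exact: (ltW (mulr_gt0 w_gt0 v0)).
  by apply: ler_wpM2l; [exact: ltW | rewrite ler_pM2l].
have JE : J = N by apply/eqP; rewrite eqn_leq JN.
have tb : P N by rewrite -JE.
have {tb} := top_bound tb; rewrite mE lee_fin -JE => tb.
have tE : t J `^ p = U * e.
  by rewrite /t powRM ?exprn_ge0 ?(ltW th_gt0) ?invr_ge0 // thXp.
rewrite tE -/v in tb.
apply: (@le_trans _ _ (Z / (e * w) * m)); last first.
  by apply: ler_pM; rewrite ?lerDl ?lerDr ?(ltW K1) ?(ltW K2).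
have vF : v * F <= Z.
  apply: ler_pM; rewrite ?(ltW v0) ?(ltW F0) //.
    apply: lerXn2r; rewrite ?nnegrE ?(ltW (s_gt0 _)) ?divr_ge0 ?(ltW R0_gt0) //.
    by have := s8 JN; lra.
  (* This puts [R0 / 2] between [2 * s J] and [16 * s J], within the range of [doubling]. *)
  have RJ : R0 <= 32 * s J by rewrite JE; exact: RN.
  rewrite /F sS; apply: doubling; first by rewrite mulr_gt0.
    by have := s8 JN; move=> *; apply/andP; split; lra.
  by rewrite ltr_pdivrMr // ltr_pMr // ltr1n.
have ew : 0 < e * w by rewrite mulr_gt0.
rewrite [leRHS]mulrAC ler_pdivlMr //.
apply: (@le_trans _ _ (v * F * (U * e * (w * v)))).
  by rewrite le_eqVlt; apply/orP; left; apply/eqP; ring.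
by apply: ler_pM; rewrite ?mulr_ge0 ?(ltW v0) ?(ltW F0) ?(ltW U0) ?(ltW w_gt0) ?(ltW e_gt0).
Qed.

(** From scale [J] on, no term of [core_bound] takes its zero branch; the smaller scales are dropped
    as nonnegative. *)
Let high_bound J (D : R) : (forall i, (J <= i <= N)%N -> ~ P i) ->
  gagliardo p nu f = D%:E ->
  r ^+ d * (\sum_(i < N.+1 | ~~ (i < J)%N) s i ^+ d * phi (s i.+1)) <= CA * D.
Proof.
move=> nP DE; have cb := core_bound; rewrite DE lee_fin in cb.
set e := 2^-1 `^ p in cb.
have ew : 0 < e * w ^+ 2 by rewrite mulr_gt0 // exprn_gt0.
rewrite /CA -/e mulrAC ler_pdivlMr // [leRHS]mulrC -ler_pdivrMr //.
apply: le_trans cb.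
have rw : 0 <= w * r ^+ d by rewrite mulr_ge0 ?exprn_ge0 ?(ltW w_gt0) ?(ltW r_gt0).
rewrite (_ : r ^+ d * _ * _ / K = (\sum_(i < N.+1 | ~~ (i < J)%N)
    e * (K^-1 * phi (s i.+1)) * (w * s i ^+ d)) * (w * r ^+ d)); last first.
  rewrite [in RHS](eq_bigr (fun i : 'I_N.+1 => (e * w / K) * (s i ^+ d * phi (s i.+1)))).
    by rewrite -mulr_sumr; ring.
  by move=> i _; ring.
apply: ler_wpM2r => //.
rewrite [leRHS](bigID (fun i : 'I_N.+1 => ~~ (i < J)%N)) /=.
rewrite [in leRHS](eq_bigr (fun i : 'I_N.+1 => e * (K^-1 * phi (s i.+1)) * (w * s i ^+ d))).
  rewrite lerDl sumr_ge0 // => i _.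
  rewrite !mulr_ge0 ?powR_ge0 ?invr_ge0 ?(ltW K_gt0) ?(ltW (F_gt0 i)) //.
  by case: ifP => // _; exact: ltW.
move=> i; rewrite -leqNgt => Ji; case: ifPn => // /asboolP Pi; exfalso.
by apply: (nP i) => //; rewrite Ji -ltnS ltn_ord.
Qed.

Lemma dyadic_sum_le_energy :
  ((r ^+ d * \sum_(i < N.+1) s i ^+ d * phi (s i.+1))%:E <=
   C%:E * (lp_mass p f + gagliardo p nu f))%E.
Proof.
have := lp_mass_ge0 p f; have := gagliardo_ge0 p nu f.
case DE : (gagliardo p nu f) => [D| |] //; last first.
  by move=> _ m0; rewrite addey ?gt0_muley ?leey // gt_eqF // (lt_le_trans _ m0).
case mE : (lp_mass p f) => [m| |] //; last first.
  by move=> _ _; rewrite addye // gt0_muley ?leey.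
rewrite !lee_fin => D0 m0.
(* The least [good] index is one more than the last scale satisfying [P], or 0 if there is none;
   [N.+1] is good vacuously. *)
pose good j := `[< forall i, (j <= i <= N)%N -> ~ P i >].
have exg : exists j, good j.
  exists N.+1; apply/asboolP => i /andP[Ni iN]; exfalso.
  by move: (leq_trans Ni iN); rewrite ltnn.
case: (ex_minnP exg) => J /asboolP goodJ Jmin.
have JN : (J <= N.+1)%N.
  apply: Jmin; apply/asboolP => i /andP[Ni iN]; exfalso.
  by move: (leq_trans Ni iN); rewrite ltnn.
rewrite (bigID (fun i : 'I_N.+1 => (i < J)%N)) /= mulrDr [C]addrC mulrDl.
have hb := high_bound goodJ DE.
have hb' : CA * D <= CA * (m + D) by rewrite ler_pM2l // lerDr.
apply: lerD; last exact: le_trans hb'.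
rewrite -(big_ord_widen N.+1 (fun i => s i ^+ d * phi (s i.+1)) JN).
(* For index 0 the low sum is empty. Otherwise, after the shift, minimality gives [P J]. *)
case: J goodJ Jmin JN {hb hb'} => [|J] goodJ Jmin JN.
  by rewrite big_ord0 mulr0 mulr_ge0 ?addr_ge0 // ltW.
apply: low_bound => //.
  apply: contrapT => nPJ; have : good J.
    apply/asboolP => i; rewrite leq_eqVlt andb_orl => /orP[/andP[/eqP <- _]//|].
    exact: goodJ.
  by move/Jmin; rewrite ltnn.
by move=> JltN; apply: goodJ; rewrite leqnn.
Qed.

End fixed_function.

(** The division by [d] in [side] makes the coordinate distances add up to less than [r]. *)
Lemma cube_sub_eball x r : 0 < r -> cube x (side r) `<=` eball x r.
Proof.
move=> r0 y xy; rewrite /eball /=; apply: le_lt_trans (enorm_le_sum _) _.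
apply: (@lt_le_trans _ _ (\sum_(i < d) side r)).
  apply: ltr_sum; last by move=> i _; rewrite !mxE; exact: xy.
  by apply/hasP; exists i0 => //; rewrite mem_index_enum.
by rewrite sumr_const card_ord -[side r *+ d]mulr_natr /side divfK ?gt_eqF.
Qed.

Hypothesis nu_int : (\int[nu]_x (Num.min 1 (enorm x `^ p))%:E < +oo)%E.

(** For [r >= rho], [hfun nu p r] is at most the constant [H], and the [L^p] mass of a competitor on
    the ball suffices. For smaller [r], [hfun_dyadic] leaves a dyadic sum, which
    [dyadic_sum_le_energy] bounds by the energy. *)
Lemma capacity_eball_ge : exists2 c1, 0 < c1 & forall r x, 0 < r ->
  ((c1 * r ^+ d)%:E * (1 + hfun nu p r) <= capacity nu p (eball x r))%E.
Proof.
pose rho := R0 / 8; have rho0 : 0 < rho by rewrite divr_gt0.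
have h0 r : (0 <= hfun nu p r)%E.
  by apply: integral_ge0 => h _; rewrite lee_fin hweight_ge0.
have [H0 HE] : 0 <= fine (hfun nu p rho) /\ hfun nu p rho = (fine (hfun nu p rho))%:E.
  by rewrite fine_ge0 ?fineK // ge0_fin_numE // hfun_lty.
move: (fine (hfun nu p rho)) H0 HE => H H0 HE.
have [C1 C10 hC1] := hfun_dyadic p_ge1 k_density phi_gt0 k_radial q12 K_ge1 growth doubling.
(* The first summand pays for [(1 + H) * r ^ d] through the core cube, of volume [2 * w * r ^ d].
   The second pays for the dyadic sum; its 2 comes from bounding both [lp_mass] and [gagliardo] by
   [X]. *)
pose c := (1 + H) / (2 * w) + C1 * (2 * C).
have c0 : 0 < c.
  by apply: addr_gt0; [apply: divr_gt0; [lra|exact: mulr_gt0]|rewrite !mulr_gt0].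
exists c^-1; first by rewrite invr_gt0.
move=> r x r0; apply: le_ereal_inf_tmp => _ [f [[mf _] ef] <-].
have fx y : cube x (side r) y -> 1 <= f y.
  by move=> /(cube_sub_eball r0)/ef/interior_subset.
rewrite EFinM -muleA lee_pdivrMl //.
have Mn := lp_mass_le_norm p_ge1 nu f; have Dn := gagliardo_le_norm p_ge1 nu f.
set X := (sobolev_norm nu p f `^ p)%E in Mn Dn *.
have X0 : (0 <= X)%E by exact: poweR_ge0.
have rX : (((1 + H) * r ^+ d)%:E <= ((1 + H) / (2 * w))%:E * X)%E.
  have M1 : ((1 `^ p * (2 * (w * r ^+ d)))%:E <= lp_mass p f)%E.
    apply: (lp_mass_ge p_ge1 mf (A := cube x (side r))) => //.
      exact: measurable_cube.
    by rewrite [leRHS]lebesgue_cube_side.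
  rewrite (_ : (1 + H) * r ^+ d = (1 + H) / (2 * w) * (1 `^ p * (2 * (w * r ^+ d)))).
    rewrite EFinM; apply: lee_wpmul2l; last exact: le_trans M1 Mn.
    by rewrite lee_fin divr_ge0 ?addr_ge0 ?mulr_ge0 // ltW.
  by rewrite powR1 mul1r; field; rewrite gt_eqF.
have r0d : 0 <= r ^+ d by rewrite exprn_ge0 // ltW.
have c1_ge0 : 0 <= (1 + H) / (2 * w) by rewrite divr_ge0 ?addr_ge0 ?mulr_ge0 // ltW.
have c2_ge0 : 0 <= C1 * (2 * C) by rewrite !mulr_ge0 // ltW.
rewrite EFinD ge0_muleDl // ?lee_fin //.
have [rhor|rrho] := leP rho r.
  apply: (@le_trans _ _ ((1 + H) * r ^+ d)%:E); last first.
    by apply: le_trans rX _; rewrite leeDl // mule_ge0 // lee_fin.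
  rewrite mulrC EFinM lee_wpmul2l ?lee_fin // EFinD leeD2l // -HE.
  exact: hfun_le.
(* With [rho = R0 / 8], the bracket [2 ^ N * r < rho <= 2 ^ (N + 1) * r] yields the hypotheses [NR]
   and [RN] on the top scale. *)
have [N /andP[N1 N2]] := dyadic_bracket r0 rrho.
have NE : 2 ^+ N.+1 * r = 2 * (2 ^+ N * r) by rewrite exprS mulrA.
rewrite NE /rho in N1 N2.
have NR : 8 * (2 ^+ N * r) < R0 by lra.
have RN : R0 <= 32 * (2 ^+ N * r) by have := R0_gt0; lra.
have hle := hC1 r rho N r0 rho0.
rewrite NE in hle.
have {}hle : (hfun nu p r <= H%:E +
    (C1 * \sum_(i < N.+1) (2 ^+ i * r) ^+ d * phi (2 ^+ i.+1 * r))%:E)%E.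
  by rewrite -HE; apply: hle; rewrite /rho //; lra.
have low := dyadic_sum_le_energy mf r0 fx NR RN.
move: low hle; set S := \sum_(i < N.+1) _ => low hle.
apply: (@le_trans _ _ (((1 + H) * r ^+ d)%:E + C1%:E * (r ^+ d * S)%:E)%E).
  rewrite -EFinM -EFinD (_ : _ + _ = r ^+ d * (1 + (H + C1 * S))); last by ring.
  by rewrite EFinM lee_wpmul2l ?lee_fin // EFinD leeD2l // EFinD.
apply: leeD; first exact: rX.
rewrite [in leRHS]EFinM -muleA lee_wpmul2l ?lee_fin ?(ltW C10) //.
apply: le_trans low _.
rewrite [2 * C]mulrC [in leRHS]EFinM -muleA lee_wpmul2l ?lee_fin ?(ltW C0) //.
by rewrite mule_natl mule2n; exact: leeD.
Qed.

End lower_bound.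

Theorem theorem3p8 (R : realType) (d : nat) (d_gt0 : (0 < d)%N)
    (p : R) (p_ge1 : 1 <= p)
    (nu : {measure set 'rV[R]_d -> \bar R})
    (nu_int : (\int[nu]_x (Order.min 1 (enorm x `^ p))%:E < +oo)%E)
    (k : 'rV[R]_d -> R) (k_density : has_density nu k)
    (phi : R -> R) (phi_gt0 : forall t : R, 0 < t -> 0 < phi t)
    (k_radial : has_radial_profile k phi)
    (phi_index : ((- d%:R - 1)%:E < lower_matuszewska0 phi)%E) :
  exists c1 c2 : R, [/\ 0 < c1, 0 < c2 &
    forall (r : R) (x : 'rV[R]_d), 0 < r ->
      ((c1 * r ^+ d)%:E * (1 + hfun nu p r) <= capacity nu p (eball x r))%E /\
      (capacity nu p (eball x r) <= (c2 * r ^+ d)%:E * (1 + hfun nu p r))%E].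
Proof.
have [q [K [R0 [q12 K_ge1 R0_gt0 growth doubling]]]] :=
  lower_matuszewska0_growth phi_gt0 phi_index.
have [c1 c1_gt0 lower] := capacity_eball_ge d_gt0 p_ge1 k_density phi_gt0
  k_radial q12 K_ge1 R0_gt0 growth doubling nu_int.
exists c1, (2 `^ p * 2 * 4 ^+ d); split=> //.
move=> r x r_gt0; split; first exact: lower.
by apply: capacity_eball_le => //; exact: hfun_lty.
Qed.
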